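(* Let $n\ge 2$, let $\Omega\subset\mathbb{R}^n$ be a bounded domain, let $0<T<\infty$ and $\Omega_T=\Omega\times(0,T)$. Let $H$ satisfy Conditions A, B and C with $k=1$ (so that $H=H(X)$, $X\in S^n$). Let $u:\Omega_T\to\mathbb{R}$ be lower semicontinuous (with no restriction on its sign) and satisfy, in the viscosity sense, $$H(D^2u)-u_t\le 0\quad\text{in }\Omega_T.$$ Set $m=\inf_{\Omega_T}u$. (a) (Hopf boundary principle) Assume that $\partial\Omega\in C^2$. Let $(p,\tau)\in\partial\Omega\times(0,T)$, and suppose that $u$ is also defined at $(p,\tau)$ with $u(p,\tau)=m$, and that $u(x,t)>m$ near $(p,\tau)$, i.e. there is a neighborhood $N\subset\mathbb{R}^{n+1}$ of $(p,\tau)$ such that $u>m$ in $N\cap\Omega_T$. Let $\gamma=(\vec{\gamma}_n,\gamma_{n+1})\in\mathbb{R}^{n}\times\mathbb{R}$ be such that $\gamma_{n+1}\le 0$, and $\vec{\gamma}_n$ is not tangential to $\partial\Omega$ (at $p$) and points towards the interior of $\Omega$. Suppose that for some small $\theta_0>0$, $(p,\tau)+\theta\gamma\in\Omega_T$ for every $\theta\in(0,\theta_0)$. Then $$\liminf_{\theta\to0^+}\frac{u(p+\theta\vec{\gamma}_n,\tau+\theta\gamma_{n+1})-u(p,\tau)}{\theta}>0.$$ (b) (Strong minimum principle) Let $(p,\tau)\in\Omega_T$ be such that $u(p,\tau)>m$. Then $u(x,t)>m$ for every $(x,t)\in\Omega\times(\tau,T)$. This holds without any assumption on the smoothness of $\partial\Omega$.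 As a consequence, if $u(p,\tau)=m$ for some $(p,\tau)\in\Omega_T$, then $u(x,t)=m$ for every $(x,t)\in\Omega\times(0,\tau)$.
   Context: $S^n$ is the set of real symmetric $n\times n$ matrices, $I$ the identity matrix, $O$ the zero matrix, and $X\le Y$ means $Y-X$ is positive semidefinite. Condition A: $H:\mathbb{R}^n\times S^n\to\mathbb{R}$ is continuous, $H(p,O)=0$ for all $p\in\mathbb{R}^n$, and $H(p,X)\le H(p,Y)$ for all $p\in\mathbb{R}^n$ and all $X\le Y$ in $S^n$. Condition B: there is a constant $k_1\ge0$ such that for all $(p,X)\in\mathbb{R}^n\times S^n$: $H(\theta p,X)=|\theta|^{k_1}H(p,X)$ for all $\theta\in\mathbb{R}$, and $H(p,\theta X)=\theta H(p,X)$ for all $\theta>0$. Set $k=k_1+1$. If $k_1=0$ (i.e. $k=1$) then $H(p,X)=H(X)$ does not depend on $p$. It is not assumed that $H$ is odd in $X$. Condition C: for $\Lambda\in\mathbb{R}$ set $$m(\Lambda)=\min\Big(\min_{|e|=1}H(e,I-\Lambda e\otimes e),\,-\max_{|e|=1}H(e,\Lambda e\otimes e-I)\Big),$$ $$M(\Lambda)=\max\Big(\max_{|e|=1}H(e,I-\Lambda e\otimes e),\,-\min_{|e|=1}H(e,\Lambda e\otimes e-I)\Big).$$ Then $m(\Lambda)>0$ for all $\Lambda<1$, and there is $\Lambda_1\ge1$ such that $M(\Lambda)<0$ for all $\Lambda\ge\Lambda_1$. Viscosity sense: $H(D^2u)-u_t\le0$ in $\Omega_T$ means that whenever $\psi$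 is $C^2$ in $x$ and $C^1$ in $t$ and $u-\psi$ has a minimum at $(y,s)\in\Omega_T$, then $H(D^2\psi(y,s))-\psi_t(y,s)\le0$. *)

(* Defs.v *)
From HB Require Import structures.
From mathcomp Require Import all_boot all_order all_algebra.
From mathcomp Require Import all_classical all_reals all_analysis.

Set Implicit Arguments.
Unset Strict Implicit.
Unset Printing Implicit Defensive.

Import Order.TTheory GRing.Theory Num.Theory.
Import numFieldNormedType.Exports.

Local Open Scope classical_set_scope.
Local Open Scope ring_scope.

(* R^n is 'rV[R]_n.  The norm of the library on 'rV[R]_n is the sup norm; it is
   only used for topological notions.  The Euclidean unit sphere is
   [unit_sphere]. *)

Definition unit_sphere (R : realType) (n : nat) : set 'rV[R]_n :=
  [set e | \sum_(i < n) e 0 i ^+ 2 = 1].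

Definition symmetric_mx (R : realType) (n : nat) : set 'M[R]_n :=
  [set X | X^T = X].

Definition psd_mx (R : realType) (n : nat) (X : 'M[R]_n) : Prop :=
  symmetric_mx X /\ forall v : 'rV[R]_n, 0 <= (v *m X *m v^T) 0 0.

Definition outer (R : realType) (n : nat) (e : 'rV[R]_n) : 'M[R]_n := e^T *m e.

(* A function on R^n x S^n is represented by a function on 'rV_n x 'M_n all of
   whose properties are only required at symmetric matrices. *)

Definition condition_A (R : realType) (n : nat)
    (H : 'rV[R]_n -> 'M[R]_n -> R) : Prop :=
  [/\ {within [set z : 'rV[R]_n * 'M[R]_n | symmetric_mx z.2],
        continuous (fun z => H z.1 z.2)},
      forall p, H p 0 = 0
    & forall p X Y, symmetric_mx X -> symmetric_mx Y -> psd_mx (Y - X) ->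
        H p X <= H p Y].

(* [powR] satisfies 0 `^ 0 = 1. *)
Definition condition_B (R : realType) (n : nat) (k : R)
    (H : 'rV[R]_n -> 'M[R]_n -> R) : Prop :=
  exists k1 : R,
    [/\ 0 <= k1,
        k = k1 + 1,
        forall p X, symmetric_mx X ->
          (forall theta : R, H (theta *: p) X = `|theta| `^ k1 * H p X) /\
          (forall theta : R, 0 < theta -> H p (theta *: X) = theta * H p X)
      & k1 = 0 -> forall p q X, symmetric_mx X -> H p X = H q X].

(* For n >= 1 and continuous H, the infima and suprema over the compact sphere
   below are attained. *)

Definition m_of (R : realType) (n : nat) (H : 'rV[R]_n -> 'M[R]_n -> R)
    (L : R) : R :=
  Num.min
    (inf [set H e (1%:M - L *: outer e) | e in @unit_sphere R n])
    (- sup [set H e (L *: outer e - 1%:M) | e in @unit_sphere R n]).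

Definition M_of (R : realType) (n : nat) (H : 'rV[R]_n -> 'M[R]_n -> R)
    (L : R) : R :=
  Num.max
    (sup [set H e (1%:M - L *: outer e) | e in @unit_sphere R n])
    (- inf [set H e (L *: outer e - 1%:M) | e in @unit_sphere R n]).

Definition condition_C (R : realType) (n : nat)
    (H : 'rV[R]_n -> 'M[R]_n -> R) : Prop :=
  (forall L, L < 1 -> 0 < m_of H L) /\
  (exists L1, 1 <= L1 /\ forall L, L1 <= L -> M_of H L < 0).

Definition bounded_domain (R : realType) (n : nat) (Omega : set 'rV[R]_n) :
    Prop :=
  [/\ Omega !=set0, open Omega, connected Omega & bounded_set Omega].

Definition cylinder (R : realType) (n : nat) (Omega : set 'rV[R]_n) (T : R) :
    set ('rV[R]_n * R) :=
  [set z | Omega z.1 /\ 0 < z.2 < T].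

(* Points outside A are isolated in [subspace A], so that nothing is required
   of u there. *)
Definition lsc_on (R : realType) (n : nat) (A : set ('rV[R]_n * R))
    (u : 'rV[R]_n * R -> R) : Prop :=
  lower_semicontinuous ((fun z => (u z)%:E) : subspace A -> \bar R).

Definition ebase (R : realType) (n : nat) (i : 'I_n) : 'rV[R]_n := delta_mx 0 i.

Definition Dx (R : realType) (n : nat) (i : 'I_n) (psi : 'rV[R]_n * R -> R) :
    'rV[R]_n * R -> R :=
  'D_(ebase R i, 0 : R) psi.

Definition Dt (R : realType) (n : nat) (psi : 'rV[R]_n * R -> R) :
    'rV[R]_n * R -> R :=
  'D_(0 : 'rV[R]_n, 1 : R) psi.

Definition hess (R : realType) (n : nat) (psi : 'rV[R]_n * R -> R)
    (z : 'rV[R]_n * R) : 'M[R]_n :=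
  \matrix_(i, j) Dx i (Dx j psi) z.

(* psi is C^2 in x and C^1 in t on the open set A: psi, psi_t, D psi and
   D^2 psi exist and are continuous on A. *)
Definition C2x_C1t_on (R : realType) (n : nat) (A : set ('rV[R]_n * R))
    (psi : 'rV[R]_n * R -> R) : Prop :=
  forall z, A z ->
    [/\ {for z, continuous psi},
        derivable psi z (0 : 'rV[R]_n, 1 : R) /\ {for z, continuous (Dt psi)},
        forall i : 'I_n, derivable psi z (ebase R i, 0 : R) /\
          {for z, continuous (Dx i psi)}
      & forall i j : 'I_n, derivable (Dx j psi) z (ebase R i, 0 : R) /\
          {for z, continuous (Dx i (Dx j psi))}].

(* H(D^2 u) - u_t <= 0 in A in the viscosity sense. *)
Definition viscosity_supersolution (R : realType) (n : nat)
    (H : 'M[R]_n -> R) (A : set ('rV[R]_n * R)) (u : 'rV[R]_n * R -> R) :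
    Prop :=
  forall (psi : 'rV[R]_n * R -> R) (z : 'rV[R]_n * R),
    C2x_C1t_on A psi -> A z ->
    (forall w, A w -> u z - psi z <= u w - psi w) ->
    H (hess psi z) - Dt psi z <= 0.

Definition boundary (R : realType) (n : nat) (Omega : set 'rV[R]_n) :
    set 'rV[R]_n :=
  closure Omega `\` Omega°.

Definition C2 (R : realType) (n : nat) (g : 'rV[R]_n -> R) : Prop :=
  forall x,
    [/\ {for x, continuous g},
        forall i : 'I_n, derivable g x (ebase R i) /\
          {for x, continuous ('D_(ebase R i) g)}
      & forall i j : 'I_n, derivable ('D_(ebase R j) g) x (ebase R i) /\
          {for x, continuous ('D_(ebase R i) ('D_(ebase R j) g))}].

(* Near each boundary point, after relabelling and reorienting the coordinate
   axes, Omega is the region above the graph of a C^2 function of n - 1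
   variables; [col' i x] is x with its i-th coordinate removed. *)
Definition C2_boundary (R : realType) (n : nat) (Omega : set 'rV[R]_n) : Prop :=
  forall p, boundary Omega p ->
    exists (i : 'I_n) (b : bool) (g : 'rV[R]_n.-1 -> R),
      C2 g /\
      \forall x \near p, Omega x <-> g (col' i x) < (-1) ^+ b * x 0 i.

(* Tangent vectors to the boundary at p are the velocities at p of curves lying
   in the boundary. *)
Definition tangent_to_boundary (R : realType) (n : nat)
    (Omega : set 'rV[R]_n) (p v : 'rV[R]_n) : Prop :=
  exists c : R -> 'rV[R]_n,
    [/\ c 0 = p,
        \forall s \near (0 : R), boundary Omega (c s)
      & is_derive (0 : R) (1 : R) c v].

Definition points_inward (R : realType) (n : nat)
    (Omega : set 'rV[R]_n) (p v : 'rV[R]_n) : Prop :=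
  \forall s \near (0 : R)^'+, Omega (p + s *: v).

Definition inf_on (R : realType) (n : nat) (A : set ('rV[R]_n * R))
    (u : 'rV[R]_n * R -> R) : \bar R :=
  ereal_inf [set (u z)%:E | z in A].

(* Main.v *)
Require Import Defs.
From HB Require Import structures.
From mathcomp Require Import all_boot all_order all_algebra.
From mathcomp Require Import all_classical all_reals all_analysis.
From mathcomp Require Import ring lra.

(** With [m] the infimum of [u], both parts compare [u - m] from below with a
    smooth strict subsolution of the form
      [psi (x, t) = A t * exp (- al * |x - y - t xi|^2) - B t].
    Where [x - y - t xi] is bounded away from 0 and [al] is large, [D^2 psi] is a
    positive multiple of [2 al z z^T - I] with [2 al |z|^2] as large as desired,
    so that [H (D^2 psi)] dominates [psi_t] by Condition C; this uses only that
    [H (Lam e e^T - I)] is bounded below by a positive constant on the unit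
    sphere.
    - Part (b): around a point where [u > m], lower semicontinuity leaves room
      for a small ball, which is moved with constant velocity [xi] along a
      segment of [Omega]; near the centre of the ball, where the gradient
      vanishes, a fast exponential decay in time makes [psi] a strict
      subsolution.  Hence positivity propagates to all later points of a ball
      contained in [Omega], and then to [Omega] by connectedness.
    - Part (a): with [xi = 0] and a Gaussian [A], [psi] is positive exactly in a
      space-time ball that touches the lateral boundary at [(p, tau)], and its
      derivative at [(p, tau)] along an inward nontangential direction is
      positive. *)

Import Order.TTheory GRing.Theory Num.Theory.
Import numFieldNormedType.Exports.

Local Open Scope classical_set_scope.
Local Open Scope ring_scope.

(** * Derivatives of the barrier *)

(** Both sides have the same difference quotients, so one-variable rules such as the chain rule
    carry over to directional derivatives. *)
Lemma is_derive_along {R : realType} {V : normedModType R} (f : V -> R)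
    (x v : V) (d : R) :
  is_derive x v f d <-> is_derive (0 : R) (1 : R) (fun h : R => f (h *: v + x)) d.
Proof.
have E : (fun h : R => h^-1 *: ((f \o shift x) (h *: v) - f x)) =
    (fun h => h^-1 *: (((fun h : R => f (h *: v + x)) \o shift 0) (h *: 1)
       - (fun h : R => f (h *: v + x)) 0)).
  by apply/funext => h /=; rewrite scale0r add0r addr0 [_%:A]mulr1.
split=> -[fx fd]; apply: DeriveDef.
- by move: fx; rewrite /derivable E.
- by move: fd; rewrite /derive E.
- by rewrite /derivable E.
- by rewrite /derive E.
Qed.

Lemma is_derive_comp_real {R : realType} {V : normedModType R} (f : V -> R)
    (g : R -> R) (x v : V) (df dg : R) :
  is_derive x v f df -> is_derive (f x) 1 g dg ->
  is_derive x v (fun z => g (f z)) (dg * df).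
Proof.
move=> /is_derive_along fd gd; apply/is_derive_along.
by apply: is_derive1_comp fd; rewrite scale0r add0r.
Qed.

Lemma is_derive_affine {R : realType} {V : normedModType R} (f : V -> R)
    (x v : V) (d : R) :
  (forall h : R, f (h *: v + x) = f x + h * d) -> is_derive x v f d.
Proof.
move=> fE; apply/is_derive_along; rewrite (funext fE).
have := @is_deriveD _ _ _ (cst (f x)) (fun h : R => h * d) 0 1 0 d _ _.
rewrite add0r; apply.
have -> : (fun h : R => h * d) = d *: (id : R -> R).
  by apply/funext => h; exact: mulrC.
rewrite -[X in is_derive _ _ _ X]mulr1; exact: is_deriveZ.
Qed.

(* The position of [z] relative to the moving centre [y + t xi], where [t] is
   the time [z.2]. *)
Definition tube_off {R : realType} {n : nat} (y xi : 'rV[R]_n)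
    (z : 'rV[R]_n * R) (i : 'I_n) : R := z.1 0 i - y 0 i - z.2 * xi 0 i.

Definition tube_sq {R : realType} {n : nat} (y xi : 'rV[R]_n)
    (z : 'rV[R]_n * R) : R := \sum_i tube_off y xi z i ^+ 2.

Definition tube_exp {R : realType} {n : nat} (al : R) (y xi : 'rV[R]_n)
    (z : 'rV[R]_n * R) : R := expR (- al * tube_sq y xi z).

Definition barrier {R : realType} {n : nat} (A B : R -> R) (al : R)
    (y xi : 'rV[R]_n) (z : 'rV[R]_n * R) : R :=
  A z.2 * tube_exp al y xi z - B z.2.

Section barrier_derivatives.
Context {R : realType} {n : nat}.
Variables (y xi : 'rV[R]_n) (al : R).
Implicit Types (z v : 'rV[R]_n * R) (i j : 'I_n) (A B : R -> R).

Local Notation off := (tube_off y xi).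
Local Notation sq := (tube_sq y xi).
Local Notation ex := (tube_exp al y xi).

Lemma is_derive_tube_off z v i :
  is_derive z v (off ^~ i) (v.1 0 i - v.2 * xi 0 i).
Proof.
apply: is_derive_affine => h; rewrite /tube_off /= !mxE.
have -> : h *: v.2 = h * v.2 by [].
ring.
Qed.

Lemma is_derive_time z v (A : R -> R) (a : R) :
  is_derive z.2 1 A a -> is_derive z v (fun z => A z.2) (a * v.2).
Proof.
move=> Aa; apply: is_derive_comp_real => //.
by apply: is_derive_affine => h /=; rewrite addrC.
Qed.

Lemma is_derive_tube_sq z v :
  is_derive z v sq (\sum_i 2 * off z i * (v.1 0 i - v.2 * xi 0 i)).
Proof.
have -> : sq = \sum_i (off ^~ i) ^+ 2.
  by apply/funext => w; rewrite fct_sumE.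
apply: is_derive_sum => i; have := is_derive_tube_off z v i => di.
by apply: is_derive_eq; rewrite expr1.
Qed.

Lemma is_derive_tube_exp z v :
  is_derive z v ex
    (ex z * (- al * \sum_i 2 * off z i * (v.1 0 i - v.2 * xi 0 i))).
Proof.
have sqd := is_derive_tube_sq z v.
exact: is_derive_comp_real.
Qed.

Lemma is_derive_barrier A B (a b : R) z v :
  is_derive z.2 1 A a -> is_derive z.2 1 B b ->
  is_derive z v (barrier A B al y xi)
   (a * v.2 * ex z + A z.2 * ex z *
     (- al * \sum_i 2 * off z i * (v.1 0 i - v.2 * xi 0 i)) - b * v.2).
Proof.
move=> dA dB.
have dA' := is_derive_time z v _ _ dA.
have dB' := is_derive_time z v _ _ dB.
have de := is_derive_tube_exp z v.
have -> : barrier A B al y xi = (fun z => A z.2) * ex - (fun z => B z.2) by [].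
apply: is_derive_eq.
by rewrite /GRing.scale /=; ring.
Qed.

End barrier_derivatives.

Lemma sum_continuous {R : realType} {T : topologicalType} {n : nat}
    (f : 'I_n -> T -> R) :
  (forall i, continuous (f i)) -> continuous (fun z => \sum_i f i z).
Proof.
by move=> fc; apply: continuous_big => // -[a b]; exact: add_continuous.
Qed.

Section barrier_regularity.
Context {R : realType} {n : nat}.
Variables (y xi : 'rV[R]_n) (al : R) (A B dA dB : R -> R).
Hypotheses (Ad : forall t, is_derive t (1 : R) A (dA t))
  (Bd : forall t, is_derive t (1 : R) B (dB t))
  (dAc : continuous dA) (dBc : continuous dB).

Local Notation off := (tube_off y xi).
Local Notation sq := (tube_sq y xi).
Local Notation ex := (tube_exp al y xi).
Local Notation psi := (barrier A B al y xi).

Lemma amplitude_continuous : continuous A.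
Proof. by move=> t; apply/differentiable_continuous/derivable1_diffP. Qed.

Lemma offset_continuous : continuous B.
Proof. by move=> t; apply/differentiable_continuous/derivable1_diffP. Qed.

Lemma tube_off_continuous i : continuous (off ^~ i).
Proof.
move=> z; apply: cvgB; last first.
  by apply: cvgM; [exact: cvg_snd|exact: cvg_cst].
apply: cvgB; last exact: cvg_cst.
apply: (@continuous_comp _ _ _ fst (fun x : 'rV[R]_n => x 0 i)).
  exact: cvg_fst.
exact: coord_continuous.
Qed.

Lemma tube_sq_continuous : continuous sq.
Proof.
apply: sum_continuous => i z.
apply: (@continuous_comp _ _ _ (off ^~ i) (fun t : R => t ^+ 2)).
  exact: tube_off_continuous.
exact: exprn_continuous.
Qed.

Lemma tube_exp_continuous : continuous ex.
Proof.
move=> z; apply: (@continuous_comp _ _ _ (fun z => - al * sq z) expR).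
  by apply: cvgM; [exact: cvg_cst|exact: tube_sq_continuous].
exact: continuous_expR.
Qed.

Lemma time_continuous (f : R -> R) :
  continuous f -> continuous (fun z : 'rV[R]_n * R => f z.2).
Proof.
move=> fc z; apply: (@continuous_comp _ _ _ (fun z : 'rV[R]_n * R => z.2) f).
  exact: cvg_snd.
exact: fc. Qed.

Lemma barrier_continuous : continuous psi.
Proof.
move=> z; apply: cvgB; last exact: time_continuous offset_continuous _.
apply: cvgM; last exact: tube_exp_continuous.
exact: time_continuous amplitude_continuous _.
Qed.

Lemma Dt_barrier : Dt psi = fun z => dA z.2 * ex z +
  A z.2 * ex z * (2 * al * \sum_i off z i * xi 0 i) - dB z.2.
Proof.
apply/funext => z; rewrite /Dt.
have := is_derive_barrier y xi al A B _ _ z (0, 1) (Ad z.2) (Bd z.2).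
move=> /@derive_val ->; rewrite /= !mulr1; congr (_ + _ - _).
rewrite !mulr_sumr; apply: eq_bigr => i _; rewrite mxE; ring.
Qed.

Lemma Dx_barrier i : Dx i psi = fun z => - (2 * al) * (A z.2 * ex z * off z i).
Proof.
apply/funext => z; rewrite /Dx.
have := is_derive_barrier y xi al A B _ _ z (ebase R i, 0) (Ad z.2) (Bd z.2).
move=> /@derive_val -> /=; rewrite !mulr0 mul0r subr0 add0r (bigD1 i) //=.
rewrite big1 => [|j ji]; last first.
  by rewrite /ebase mxE (negbTE ji) andbF mul0r subr0 mulr0.
by rewrite /ebase mxE !eqxx /=; ring.
Qed.

Lemma is_derive_Dx_barrier i j z :
  is_derive z (ebase R i, 0 : R) (Dx j psi)
   (2 * al * (A z.2 * ex z) * (2 * al * (off z i * off z j) - (i == j)%:R)).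
Proof.
rewrite Dx_barrier.
(* The first derivative is a multiple of a barrier with [B = 0] times a coordinate of [off], so the
   product rule can reuse [is_derive_barrier]. *)
have -> : (fun z => - (2 * al) * (A z.2 * ex z * off z j)) =
    (- (2 * al)) *: (barrier A (cst 0) al y xi * (off ^~ j)).
  apply/funext => w; congr (_ * (_ * _)).
  by rewrite /barrier /cst subr0.
have db := is_derive_barrier y xi al A (cst 0) _ _ z (ebase R i, 0)
  (Ad z.2) (is_derive_cst _ _ _).
have dof := is_derive_tube_off y xi z (ebase R i, 0) j.
apply: is_derive_eq (is_deriveZ (- (2 * al)) (is_deriveM db dof)) _.
rewrite /= /barrier /cst.
rewrite !mulr0 !mul0r !subr0 add0r (bigD1 i) //=.
rewrite big1 => [|k ki]; last first.
  by rewrite /ebase mxE (negbTE ki) andbF mul0r subr0 mulr0.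
rewrite /ebase !mxE !eqxx /= eq_sym /GRing.scale /=; ring.
Qed.

Lemma Dxx_barrier i j : Dx i (Dx j psi) = fun z =>
  2 * al * (A z.2 * ex z) * (2 * al * (off z i * off z j) - (i == j)%:R).
Proof.
apply/funext => z; rewrite /Dx -/(Dx j psi).
by have /@derive_val := is_derive_Dx_barrier i j z.
Qed.

Lemma barrier_C2x_C1t (D : set ('rV[R]_n * R)) : C2x_C1t_on D psi.
Proof.
move=> z _.
have exA : continuous (fun z => A z.2 * ex z).
  move=> w; apply: cvgM; last exact: tube_exp_continuous.
  exact: time_continuous amplitude_continuous _.
split.
- exact: barrier_continuous.
- split.
    by have [] := is_derive_barrier y xi al A B _ _ z (0, 1) (Ad z.2) (Bd z.2).
  rewrite Dt_barrier; apply: cvgB; last exact: time_continuous.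
  apply: cvgD.
    by apply: cvgM; [exact: time_continuous|exact: tube_exp_continuous].
  apply: cvgM; first exact: exA.
  apply: cvgM; first exact: cvg_cst.
  move: z; apply: sum_continuous => i z.
  by apply: cvgM; [exact: tube_off_continuous|exact: cvg_cst].
- move=> i; split.
    by have [] := is_derive_barrier y xi al A B _ _ z (ebase R i, 0) (Ad z.2) (Bd z.2).
  rewrite Dx_barrier; apply: cvgM; first exact: cvg_cst.
  by apply: cvgM; [exact: exA|exact: tube_off_continuous].
- move=> i j; split; first by have [] := is_derive_Dx_barrier i j z.
  rewrite Dxx_barrier.
  apply: cvgM; first by apply: cvgM; [exact: cvg_cst|exact: exA].
  apply: cvgB; last exact: cvg_cst.
  apply: cvgM; first exact: cvg_cst.
  by apply: cvgM; exact: tube_off_continuous.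
Qed.

(** This is the shape to which Condition C applies: once homogeneity removes the scalar factor,
    positive for positive [al] and [A], a rank-one matrix minus the identity remains. *)
Lemma hess_barrier z : hess psi z = (2 * al * (A z.2 * ex z)) *:
  ((2 * al) *: outer (\row_i off z i) - 1%:M).
Proof.
apply/matrixP => i j; rewrite !mxE.
rewrite Dxx_barrier.
by rewrite big_ord1 !mxE.
Qed.

End barrier_regularity.

(** * Comparison with strict subsolutions *)

(** The sublevel sets of [f] in [K] are nested, hence generate a proper filter. At a cluster point
    [p] of it, a value [f x < f p] would, by lower semicontinuity, give a neighbourhood of [p]
    disjoint from the sublevel set of [x]. *)
Lemma compact_lsc_min {R : realType} {T : topologicalType} (f : T -> R)
    (K : set T) :
  K !=set0 -> compact K ->
  (forall x, K x -> forall a, a < f x -> \forall y \near x, a < f y) ->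
  exists2 x, K x & forall y, K y -> f x <= f y.
Proof.
move=> [x0 Kx0] cK fl.
pose F : set_system T :=
  [set S | exists2 x, K x & [set y | K y /\ f y <= f x] `<=` S].
have FF : ProperFilter F.
  split=> [[x Kx /(_ x)]|]; first by apply; split.
  split.
  - by exists x0.
  - move=> P Q [x Kx Px] [y Ky Qy].
    have [xy|/ltW yx] := leP (f x) (f y); [exists x => //|exists y => //].
      by move=> w [Kw wx]; split; [exact: Px|apply: Qy; split; rewrite ?(le_trans wx)].
    by move=> w [Kw wx]; split; [apply: Px; split; rewrite ?(le_trans wx)|exact: Qy].
  - by move=> P Q PQ [x Kx Px]; exists x => //; exact: subset_trans PQ.
have [|p [Kp pF]] := cK F FF; first by exists x0 => // y [].
exists p => // x Kx; rewrite leNgt; apply/negP => xp.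
have [||y [[Ky yx] /=]] := pF [set y | K y /\ f y <= f x] [set y | f x < f y].
- by exists x.
- exact: fl.
- by rewrite ltNge yx.
Qed.

Lemma lsc_on_near {R : realType} {n : nat} (A : set ('rV[R]_n * R))
    (u : 'rV[R]_n * R -> R) (z : 'rV[R]_n * R) (a : R) :
  open A -> lsc_on A u -> A z -> a < u z -> \forall w \near z, a < u w.
Proof.
move=> oA lu Az az.
have [|V nV Va] := lu z a; first by rewrite lte_fin.
have nV' : \forall w \near z, A w -> V w.
  by rewrite -[\near z, _]/(within A (nbhs z) V) nbhs_subspace_in.
have nA : nbhs z A by exact: open_nbhs_nbhs.
by apply: filterS2 _ nV' nA => w Vw Aw; rewrite -lte_fin; apply/Va/Vw.
Qed.

(** If [u] were below [m + psi] at [z], by an amount [c > 0], then [u - psi] would attain its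
    minimum over [A] in the compact set that contains [c <= psi]. At the minimum point [psi > 0] and
    [u < m + psi], so testing the supersolution property with [psi] contradicts the strict
    inequality assumed there. *)
Lemma comparison {R : realType} {n : nat} (H : 'M[R]_n -> R)
    (A : set ('rV[R]_n * R)) (u psi : 'rV[R]_n * R -> R) (m : R) :
  open A -> lsc_on A u -> viscosity_supersolution H A u ->
  (forall z, A z -> m <= u z) -> C2x_C1t_on A psi ->
  (forall c, 0 < c -> exists K : set ('rV[R]_n * R),
     [/\ compact K, K `<=` A & forall z, A z -> c <= psi z -> K z]) ->
  (forall z, A z -> 0 < psi z -> u z < m + psi z ->
     0 < H (hess psi z) - Dt psi z) ->
  forall z, A z -> m + psi z <= u z.
Proof.
move=> oA lu su mu psiC psiK psiH z Az; rewrite leNgt; apply/negP => uz.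
pose c := m + psi z - u z.
have c0 : 0 < c by rewrite subr_gt0.
have [K [cK KA Kc]] := psiK _ c0.
have Kz : K z by apply: Kc => //; rewrite /c; have := mu _ Az; lra.
have [||z1 Kz1 z1min] := @compact_lsc_min R _ (fun w => u w - psi w) K _ cK.
- by exists z.
- move=> x Kx a ax; pose d := (u x - psi x - a) / 2.
  have d0 : 0 < d by rewrite /d; lra.
  have nu : \forall w \near x, u x - d < u w.
    by apply: (lsc_on_near A) => //; [exact: KA|rewrite ltrBlDr ltrDl].
  have [/cvgrPdist_lt /(_ _ d0) npsi _ _ _] := psiC _ (KA _ Kx).
  apply: filterS2 _ nu npsi => w; rewrite ltr_norml => u1 /andP[p1 p2].
  by move: d0 u1 p1 p2; rewrite /d; lra.
have z1z := z1min _ Kz.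
have m1 := mu _ (KA _ Kz1).
(* Off [K], [u - psi > m - c = u z - psi z], and this is at least the minimum over [K]. *)
have /= min1 w : A w -> u z1 - psi z1 <= u w - psi w.
  move=> Aw; have [Kw|nKw] := pselect (K w); first exact: z1min.
  have : psi w < c by rewrite ltNge; apply/negP => /(Kc _ Aw).
  by have := mu _ Aw; move: z1z; rewrite /c; lra.
have : 0 < H (hess psi z1) - Dt psi z1.
  apply: psiH; first exact: KA.
  - by move: z1z m1 c0; rewrite /c; lra.
  - by move: z1z m1 c0; rewrite /c; lra.
by rewrite ltNge; move/negP; apply; apply: su => //; exact: KA.
Qed.

(** * Rank-one perturbations of scalar matrices, time cut-offs and moving tubes *)

Lemma outer_sym {R : realType} {n : nat} (e : 'rV[R]_n) : (outer e)^T = outer e.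
Proof. by rewrite /outer trmx_mul trmxK. Qed.

Lemma outer_scale_sym {R : realType} {n : nat} (a b : R) (e : 'rV[R]_n) :
  symmetric_mx (a *: outer e + b%:M).
Proof.
by rewrite /symmetric_mx /= linearD /= linearZ /= outer_sym tr_scalar_mx.
Qed.

(** The quadratic form at [v] is [a] times the square of [v *m e^T] plus [b] times the squared
    length of [v]. *)
Lemma psd_outer_scalar {R : realType} {n : nat} (a b : R) (e : 'rV[R]_n) :
  0 <= a -> 0 <= b -> psd_mx (a *: outer e + b%:M).
Proof.
move=> a0 b0; split=> [|v]; first exact: outer_scale_sym.
have sq k (w : 'rV[R]_k) : 0 <= (w *m w^T) 0 0.
  by rewrite mxE sumr_ge0 // => i _; rewrite mxE -expr2 sqr_ge0.
rewrite mulmxDr mulmxDl -scalemxAr -scalemxAl mul_mx_scalar -scalemxAl.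
have -> : v *m outer e *m v^T = (v *m e^T) *m (v *m e^T)^T.
  by rewrite /outer trmx_mul trmxK !mulmxA.
by rewrite mxE [X in X + _]mxE [X in _ + X]mxE addr_ge0 ?mulr_ge0.
Qed.

Lemma outer_subr1 {R : realType} {n : nat} (a : R) (e : 'rV[R]_n) :
  a *: outer e - 1%:M = a *: outer e + (- 1)%:M.
Proof. by rewrite raddfN. Qed.

(** The squared positive part serves as a time cut-off that is C^1 and vanishes on a half-line. At
    the corner, its slope function [Num.max z 0] is continuous. *)
Lemma is_derive_sqr_pos {R : realType} (x : R) :
  is_derive x (1 : R) (fun t : R => Num.max t 0 ^+ 2) (2 * Num.max x 0).
Proof.
have [x0|x0|->] := ltgtP x 0.
- rewrite mulr0; apply: (@near_eq_is_derive R R R (cst 0)).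
  near=> z; rewrite /= max_r ?expr0n //; near: z.
  by apply: filterS (lt_nbhsl x0) => y /ltW.
- apply: (@near_eq_is_derive _ _ _ (fun t : R => t ^+ 2)).
    near=> z; rewrite /= max_l //; near: z.
    by apply: filterS (lt_nbhsr x0) => y /ltW.
  have := @is_deriveX _ _ (id : R -> R) 2 x 1 1 _.
  by rewrite expr1 [_ *: 1]mulr1; exact.
- apply/is_derive1_caratheodory; exists (fun z : R => Num.max z 0); split.
  + move=> z; rewrite maxxx expr0n /= !subr0 expr2.
    by have [z0|z0] := leP z 0; rewrite ?mul0r.
  + apply: continuous_max; [exact: cvg_id|exact: cvg_cst].
  + by rewrite maxxx mulr0.
Unshelve. all: by end_near. Qed.

Lemma tube_sq_ge0 {R : realType} {n : nat} (y xi : 'rV[R]_n) z :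
  0 <= tube_sq y xi z.
Proof. by apply: sumr_ge0 => i _; exact: sqr_ge0. Qed.

Lemma tube_off_le {R : realType} {n : nat} (y xi : 'rV[R]_n) z r i :
  0 <= r -> tube_sq y xi z <= r ^+ 2 -> `|tube_off y xi z i| <= r.
Proof.
move=> r0 zr; rewrite -(@ler_pXn2r _ 2) ?nnegrE //.
rewrite real_normK ?num_real //; apply: le_trans zr.
by rewrite /tube_sq (bigD1 i) //= lerDl; apply: sumr_ge0 => j _; exact: sqr_ge0.
Qed.

(** The tube is closed and lies in the product of a box with [[t1, t2]]: up to these times the
    centre drifts by at most [|t1| + |t2|] times the speed in each coordinate. *)
Lemma compact_tube {R : realType} {n : nat} (y xi : 'rV[R]_n) (t1 t2 r : R) :
  0 <= r ->
  compact [set z : 'rV[R]_n * R | t1 <= z.2 <= t2 /\ tube_sq y xi z <= r ^+ 2].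
Proof.
move=> r0.
pose M i := r + `|y 0 i| + (`|t1| + `|t2|) * `|xi 0 i|.
have cB : compact [set v : 'rV[R]_n | forall i, `[- M i, M i]%classic (v ord0 i)].
  apply: (@rV_compact _ _ (fun i => `[- M i, M i]%classic)) => i.
  exact: segment_compact.
apply: subclosed_compact (compact_setX cB (@segment_compact _ t1 t2)) _.
- have -> : [set z : 'rV[R]_n * R | t1 <= z.2 <= t2 /\ tube_sq y xi z <= r ^+ 2] =
    (snd @^-1` `[t1, t2]%classic) `&` (tube_sq y xi @^-1` [set x | x <= r ^+ 2]).
    by apply/seteqP; split=> z /=; rewrite in_itv /=.
  apply: closedI; apply: closed_comp => [z _|].
  + exact: cvg_snd.
  + exact: interval_closed.
  + exact: tube_sq_continuous.
  + exact: closed_le.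
- move=> z [/= /andP[z1 z2] zr]; split; last by rewrite /= in_itv /= z1.
  move=> i /=; rewrite in_itv /= -ler_norml.
  have /= := tube_off_le y xi z r i r0 zr.
  have -> : z.1 ord0 i = tube_off y xi z i + y 0 i + z.2 * xi 0 i.
    by rewrite /tube_off; ring.
  move=> ole; apply: le_trans (ler_normD _ _) _; apply: lerD.
    by apply: le_trans (ler_normD _ _) _; rewrite lerD2r.
  rewrite normrM ler_wpM2r //.
  have := ler_norm t2; have := ler_norm (- t1); rewrite normrN.
  have := normr_ge0 t1; have := normr_ge0 t2.
  by rewrite ler_norml => *; apply/andP; lra.
Qed.

(** Controls the contribution of the moving centre to the time derivative of the barrier. *)
Lemma tube_drift_le {R : realType} {n : nat} (y xi : 'rV[R]_n) z r :
  0 <= r -> tube_sq y xi z <= r ^+ 2 ->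
  \sum_i tube_off y xi z i * xi 0 i <= r * \sum_i `|xi 0 i|.
Proof.
move=> r0 zr; rewrite mulr_sumr; apply: ler_sum => i _.
apply: le_trans (ler_norm _) _; rewrite normrM ler_wpM2r //.
exact: tube_off_le.
Qed.

Lemma is_derive_expRZ {R : realType} (c a t : R) :
  is_derive t (1 : R) (fun t => c * expR (a * t)) (a * (c * expR (a * t))).
Proof.
have h : is_derive t (1 : R) (fun t => a * t) a.
  by apply: is_derive_affine => h; rewrite [h *: 1]mulr1; ring.
have := @is_deriveZ _ _ _ (expR \o (fun t => a * t)) c t 1 _ _.
move/(_ _ (is_derive1_comp _ h)) => d.
by apply: is_derive_eq; rewrite /GRing.scale /=; ring.
Qed.

Lemma cylinder_open {R : realType} {n : nat} (Omega : set 'rV[R]_n) (T : R) :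
  open Omega -> open (cylinder Omega T).
Proof.
move=> oO.
have -> : cylinder Omega T = (fst @^-1` Omega) `&` (snd @^-1` `]0, T[%classic).
  by apply/seteqP; split=> z /=; rewrite in_itv.
apply: openI; apply: open_comp => [z _|].
- exact: cvg_fst.
- exact: oO.
- exact: cvg_snd.
- exact: interval_open.
Qed.

Lemma rV_ball {R : realType} {n : nat} (x v : 'rV[R]_n) (e : R) :
  0 < e -> ball x e v <-> forall i, `|v 0 i - x 0 i| < e.
Proof.
move=> e0; split=> [[_ xv] i|xv].
  by have := xv 0 i; rewrite -ball_normE /= distrC.
by split=> // i j; rewrite ord1 -ball_normE /= distrC.
Qed.

Lemma near_box {R : realType} {n : nat} (p : 'rV[R]_n) (s : R)
    (P : 'rV[R]_n * R -> Prop) :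
  (\forall z \near (p, s), P z) -> exists2 r : R, 0 < r &
    forall z : 'rV[R]_n * R, (forall i, `|z.1 0 i - p 0 i| < r) -> `|z.2 - s| < r -> P z.
Proof.
move=> /nbhs_ballP [r /= r0 rP]; exists r => // z zp zs; apply: rP; split=> /=.
  exact/rV_ball.
by rewrite -ball_normE /= distrC.
Qed.

(** * Elliptic operators *)

Section elliptic_operator.
Context {R : realType} {n : nat}.
Variables (H : 'M[R]_n -> R) (Lam c0 : R).
Hypotheses (Lam1 : 1 <= Lam) (c00 : 0 < c0).
Hypothesis Hmono : forall X Y, symmetric_mx X -> symmetric_mx Y ->
  psd_mx (Y - X) -> H X <= H Y.
Hypothesis Hhom : forall X, symmetric_mx X -> forall a, 0 < a ->
  H (a *: X) = a * H X.
Hypothesis Hpos : forall e, unit_sphere e -> c0 <= H (Lam *: outer e - 1%:M).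

(** A crude bound for points near the axis of a tube, where the rank-one term is too small for
    Condition C to help. *)
Lemma H_outer_ge_opp1 a (e : 'rV[R]_n) :
  0 <= a -> H (- 1%:M) <= H (a *: outer e - 1%:M).
Proof.
move=> a0; apply: Hmono.
- by rewrite /symmetric_mx /= linearN /= tr_scalar_mx.
- by rewrite outer_subr1; exact: outer_scale_sym.
- rewrite opprK subrK -[X in psd_mx X]addr0 -(raddf0 (@scalar_mx R n)).
  exact: psd_outer_scalar.
Qed.

(** With [e] the normalization of [z], the matrix minus [L] times [Lam *: outer e - 1%:M] is a
    nonnegative multiple of [outer e] plus [(L - 1)%:M], hence positive semidefinite. Monotonicity
    and homogeneity then give a bound that grows linearly in [L]. *)
Lemma H_outer_ge L a (z : 'rV[R]_n) : 0 < \sum_i z 0 i ^+ 2 -> 1 <= L ->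
  L * Lam <= a * \sum_i z 0 i ^+ 2 -> L * c0 <= H (a *: outer z - 1%:M).
Proof.
set s := \sum_i _ => s0 L1 Ls.
have r0 : 0 < Num.sqrt s by rewrite sqrtr_gt0.
have rs : s = Num.sqrt s * Num.sqrt s by rewrite -expr2 sqr_sqrtr ?ltW.
pose e := (Num.sqrt s)^-1 *: z.
have ee : unit_sphere e.
  rewrite /unit_sphere /=; under eq_bigr do rewrite mxE exprMn.
  by rewrite -mulr_sumr -/s exprVn sqr_sqrtr ?ltW // mulVf ?gt_eqF.
have ze : outer z = s *: outer e.
  rewrite /outer /e !linearZ /= -scalemxAl !scalerA -[LHS]scale1r.
  by congr (_ *: _); rewrite [X in _ * X / _]rs; field; rewrite gt_eqF.
have L0 : 0 < L by lra.
apply: (@le_trans _ _ (H (L *: (Lam *: outer e - 1%:M)))).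
  rewrite Hhom //; first by rewrite ler_wpM2l ?Hpos // ltW.
  by rewrite outer_subr1; exact: outer_scale_sym.
apply: Hmono.
- by rewrite outer_subr1 scalerDr scalerA scale_scalar_mx; exact: outer_scale_sym.
- by rewrite outer_subr1; exact: outer_scale_sym.
rewrite ze.
have -> : a *: (s *: outer e) - 1%:M - L *: (Lam *: outer e - 1%:M) =
   (a * s - L * Lam) *: outer e + (L - 1)%:M.
  move: (outer e) => O; apply/matrixP => i j.
  by rewrite !mxE -(mulr_natr (L - 1)); ring.
by apply: psd_outer_scalar; rewrite subr_ge0.
Qed.

Lemma H_hess_barrier (A B dA dB : R -> R) (y xi : 'rV[R]_n) (al : R) z :
  (forall t, is_derive t (1 : R) A (dA t)) ->
  (forall t, is_derive t (1 : R) B (dB t)) ->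
  0 < al -> 0 < A z.2 ->
  H (hess (barrier A B al y xi) z) = 2 * al * (A z.2 * tube_exp al y xi z) *
    H ((2 * al) *: outer (\row_i tube_off y xi z i) - 1%:M).
Proof.
move=> dA' dB' al0 Az; rewrite (hess_barrier y xi al A B dA dB) // Hhom //.
- by rewrite outer_subr1; exact: outer_scale_sym.
- by rewrite !mulr_gt0 // expR_gt0.
Qed.

(** A gap [del] between [u] and [m] on an initial slab of the tube is carried along the moving ball
    up to time [s']. The barrier compares [u] with a bump that moves with the ball and decays in
    time at rate [a]. *)
Lemma tube_positivity (A : set ('rV[R]_n * R)) (u : 'rV[R]_n * R -> R)
    (m : R) (y xi : 'rV[R]_n) (s s' rho eta del : R) :
  open A -> lsc_on A u -> viscosity_supersolution H A u ->
  (forall z, A z -> m <= u z) -> (forall z, A z -> 0 < z.2) ->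
  0 < rho -> 0 < eta -> 0 < del ->
  (forall z, s - eta <= z.2 <= s' + eta -> tube_sq y xi z <= rho ^+ 2 -> A z) ->
  (forall z, s - eta <= z.2 <= s -> tube_sq y xi z <= rho ^+ 2 -> m + del <= u z) ->
  forall z, s <= z.2 <= s' -> tube_sq y xi z < rho ^+ 2 -> m < u z.
Proof.
move=> oA lu su mu A0 rho0 eta0 del0 tubeA init.
pose X := \sum_i `|xi 0 i|.
have X0 : 0 <= X by apply: sumr_ge0.
(* With this [L], the bound [L * c0] of [H_outer_ge] exceeds the drift bound [rho * X]. *)
pose L := 1 + rho * X / c0.
have L1 : 1 <= L by rewrite lerDl divr_ge0 ?mulr_ge0 // ltW.
have Lc0 : L * c0 = c0 + rho * X by rewrite /L mulrDl mul1r divfK ?gt_eqF.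
(* Chosen so that [2 * al * tube_sq] reaches [L * Lam] as soon as [tube_sq] is at least
   [rho ^+ 2 / 4]. *)
pose al := 2 * (L * Lam) / rho ^+ 2.
have LLam : 1 <= L * Lam by rewrite -[1]mulr1 ler_pM.
have rho20 : 0 < rho ^+ 2 by rewrite exprn_gt0.
have alrho : al * rho ^+ 2 = 2 * (L * Lam) by rewrite divfK ?gt_eqF.
have al0 : 0 < al by rewrite divr_gt0 //; lra.
pose h0 := `|H (- 1%:M)|.
have h00 : 0 <= h0 by exact: normr_ge0.
(* Half of this decay rate exceeds by 1/2 the worst loss [2 * al * (h0 + rho * X)] near the axis of
   the tube. *)
pose a := 4 * al * (h0 + rho * X) + 1.
have rX0 : 0 <= rho * X by rewrite mulr_ge0 // ltW.
have a0 : 0 < a.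
  by rewrite /a; have := mulr_ge0 (ltW al0) (addr_ge0 h00 rX0); lra.
pose E0 := expR (- al * rho ^+ 2).
have E00 : 0 < E0 by exact: expR_gt0.
pose K := del / eta ^+ 2.
have eta20 : 0 < eta ^+ 2 by rewrite exprn_gt0.
have K0 : 0 < K by rewrite divr_gt0.
have Keta : K * eta ^+ 2 = del by rewrite divfK ?gt_eqF.
(* [psi = At * (tube_exp - E0) - K * c] is positive only inside the tube, as
   [E0] is the value of [tube_exp] on its lateral boundary, and only for
   [s - eta < t < s' + eta], as [K * eta ^+ 2] bounds the first term. *)
pose At t := del * expR (- a * t).
pose c t := Num.max (t - s') 0 ^+ 2 + Num.max (s - t) 0 ^+ 2.
pose Bt t := E0 * At t + K * c t.
pose dB t := E0 * (- a * At t) +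
  K * (2 * Num.max (t - s') 0 - 2 * Num.max (s - t) 0).
have dAt t : is_derive t (1 : R) At (- a * At t) by exact: is_derive_expRZ.
have dc t : is_derive t (1 : R) c (2 * Num.max (t - s') 0 - 2 * Num.max (s - t) 0).
  have h1 : is_derive t (1 : R) (fun t => t - s') 1.
    by apply: is_derive_affine => h; rewrite [h *: 1]mulr1; ring.
  have h2 : is_derive t (1 : R) (fun t => s - t) (- 1).
    by apply: is_derive_affine => h; rewrite [h *: 1]mulr1; ring.
  have d1 := is_derive_comp_real _ _ _ _ _ _ h1 (is_derive_sqr_pos (t - s')).
  have d2 := is_derive_comp_real _ _ _ _ _ _ h2 (is_derive_sqr_pos (s - t)).
  have := is_deriveD d1 d2; rewrite mulr1 mulrN1; exact.
have dBt t : is_derive t (1 : R) Bt (dB t).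
  exact: (is_deriveD (is_deriveZ E0 (dAt t)) (is_deriveZ K (dc t))).
have At0 t : 0 < At t by rewrite mulr_gt0 ?expR_gt0.
have Ac : continuous At := amplitude_continuous At _ dAt.
have pos_c (f : R -> R) : continuous f -> continuous (fun t => Num.max (f t) 0).
  by move=> fc t; apply: continuous_max; [exact: fc|exact: cvg_cst].
have dAc : continuous (fun t => - a * At t).
  by move=> t; apply: cvgM; [exact: cvg_cst|exact: Ac].
have dBc : continuous dB.
  move=> t; apply: cvgD; first by apply: cvgM; [exact: cvg_cst|exact: dAc].
  apply: cvgM; first exact: cvg_cst.
  apply: cvgB; apply: cvgM; try exact: cvg_cst.
    apply: (pos_c (fun x => x - s')) => x.
    by apply: cvgB; [exact: cvg_id|exact: cvg_cst].
  apply: (pos_c (fun x => s - x)) => x.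
  by apply: cvgB; [exact: cvg_cst|exact: cvg_id].
pose psi := barrier At Bt al y xi.
have psiE z : psi z = At z.2 * (tube_exp al y xi z - E0) - K * c z.2.
  by rewrite /psi /barrier /Bt; ring.
have c_ge0 t : 0 <= c t by rewrite addr_ge0 // sqr_ge0.
have ex1 z : tube_exp al y xi z <= 1.
  rewrite -expR0 ler_expR mulNr oppr_le0 mulr_ge0 ?tube_sq_ge0 //; exact: ltW.
have Adel z : A z -> At z.2 <= del.
  move=> /A0 z0; rewrite -[leRHS]mulr1 ler_wpM2l ?(ltW del0) //.
  by rewrite -expR0 ler_expR mulNr oppr_le0 mulr_ge0 // ltW.
have psidel z : A z -> psi z <= del.
  move=> Az; rewrite psiE; have := Adel _ Az; have := At0 z.2; have := ex1 z.
  have : 0 <= K * c z.2 by rewrite mulr_ge0 // ltW.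
  by have := expR_gt0 (- al * tube_sq y xi z); rewrite -/(tube_exp al y xi z); nra.
have ex_sq z : E0 < tube_exp al y xi z -> tube_sq y xi z < rho ^+ 2.
  by rewrite ltr_expR !mulNr ltrN2 ltr_pM2l.
have psi_sq z : 0 < psi z -> tube_sq y xi z < rho ^+ 2.
  rewrite psiE => p0; apply: ex_sq; rewrite -subr_gt0 -(pmulr_rgt0 _ (At0 z.2)).
  by apply: lt_le_trans p0 _; rewrite lerBlDr lerDl mulr_ge0 // ltW.
have psi_t z : A z -> 0 < psi z -> s - eta <= z.2 <= s' + eta.
  move=> Az; rewrite psiE => p0.
  have ceta : c z.2 < eta ^+ 2.
    rewrite -(ltr_pM2l K0) Keta; have := Adel _ Az; have := At0 z.2; have := ex1 z.
    by have := expR_gt0 (- al * tube_sq y xi z); rewrite -/(tube_exp al y xi z); nra.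
  have m1 : Num.max (z.2 - s') 0 < eta.
    rewrite -(@ltr_pXn2r _ 2) ?nnegrE ?le_max ?lexx ?orbT ?(ltW eta0) //.
    by apply: le_lt_trans ceta; rewrite lerDl sqr_ge0.
  have m2 : Num.max (s - z.2) 0 < eta.
    rewrite -(@ltr_pXn2r _ 2) ?nnegrE ?le_max ?lexx ?orbT ?(ltW eta0) //.
    by apply: le_lt_trans ceta; rewrite lerDr sqr_ge0.
  move: m1 m2; rewrite !gt_max => /andP[m1 _] /andP[m2 _]; apply/andP; lra.
have comp z : A z -> m + psi z <= u z.
  apply: (comparison H A) => //.
  - exact: barrier_C2x_C1t.
  - move=> e e0.
    exists [set z | s - eta <= z.2 <= s' + eta /\ tube_sq y xi z <= rho ^+ 2]; split.
    + by apply: compact_tube; exact: ltW.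
    + by move=> w [wt ws]; exact: tubeA.
    + move=> w Aw ew; have w0 : 0 < psi w by exact: lt_le_trans ew.
      by split; [exact: psi_t|exact/ltW/psi_sq].
  move=> {}z Az p0 uz.
  (* Up to time [s] the initial gap [del] dominates [psi], so contact can only occur later. There
     the early cut-off vanishes, and the late one contributes to [- psi_t] with a favourable
     sign. *)
  have zs : s < z.2.
    rewrite ltNge; apply/negP => zs.
    have /andP[st _] := psi_t _ Az p0.
    have : m + del <= u z by apply: init; [rewrite st|exact/ltW/psi_sq].
    by have := psidel _ Az; lra.
  have sq := psi_sq _ p0.
  rewrite /psi (H_hess_barrier _ _ (fun t => - a * At t) dB) //.
  rewrite (Dt_barrier y xi al At Bt (fun t => - a * At t) dB) //.
  set e := tube_exp al y xi z; set S := \sum_i _; set Hv := H _.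
  have e0 : 0 < e by exact: expR_gt0.
  have SX : S <= rho * X by apply: tube_drift_le; exact: ltW.
  have m2 : Num.max (s - z.2) 0 = 0 by apply/max_idPr; lra.
  have m1 : 0 <= Num.max (z.2 - s') 0 by rewrite le_max lexx orbT.
  rewrite /dB m2.
  (* Up to the factor [At] and the nonnegative cut-off term, this is [H (hess psi z) - Dt psi z]. *)
  suff main : 0 < 2 * al * e * (Hv - S) + a * (e - E0).
    have := mulr_gt0 (At0 z.2) main.
    have : 0 <= K * Num.max (z.2 - s') 0 by rewrite mulr_ge0 // ltW.
    move: (At z.2) (Num.max (z.2 - s') 0) => A1 M1; nra.
  have rowE : \sum_i (\row_i tube_off y xi z i) 0 i ^+ 2 = tube_sq y xi z.
    by apply: eq_bigr => i _; rewrite mxE.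
  have eE0 : 0 < e - E0 by rewrite subr_gt0 ltr_expR !mulNr ltrN2 ltr_pM2l.
  (* Far from the axis the Hessian term beats the drift. Near the axis [e - E0] is at least [e / 2],
     and the decay rate [a] absorbs both the drift and the bad Hessian bound. *)
  have [far|near] := lerP (rho ^+ 2 / 4) (tube_sq y xi z).
    have HvL : L * c0 <= Hv.
      apply: H_outer_ge => //; rewrite rowE.
        by apply: lt_le_trans far; rewrite divr_gt0.
      apply: (@le_trans _ _ (2 * al * (rho ^+ 2 / 4))).
        by have := alrho; lra.
      by rewrite ler_pM2l // mulr_gt0.
    have HvS : 0 <= Hv - S.
      by rewrite subr_ge0 (le_trans SX) // (le_trans _ HvL) // Lc0 lerDr ltW.
    have := mulr_ge0 (mulr_ge0 (ltW al0) (ltW e0)) HvS.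
    by have := mulr_gt0 a0 eE0; lra.
  have Hvh : - h0 <= Hv.
    apply: (@le_trans _ _ (H (- 1%:M))); first by rewrite lerNl /h0 -normrN ler_norm.
    by apply: H_outer_ge_opp1 => //; rewrite mulr_ge0 // ltW.
  (* The exponent [al * (rho ^+ 2 - tube_sq)] is at least [3/2 * L * Lam >= 3/2], and
     [1 + x <= expR x]. *)
  have eE2 : 2 * E0 <= e.
    have -> : e = E0 * expR (al * (rho ^+ 2 - tube_sq y xi z)).
      by rewrite /e /tube_exp /E0 -expRD; congr expR; ring.
    rewrite mulrC ler_pM2l //.
    apply: le_trans _ (expR_ge1Dx _).
    have : al * tube_sq y xi z <= al * (rho ^+ 2 / 4) by rewrite ler_pM2l // ltW.
    by rewrite mulrBr alrho mulrA alrho; lra.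
  have : 2 * al * e * (Hv - S) >= 2 * al * e * (- h0 - rho * X).
    rewrite ler_pM2l; first by lra.
    by apply: mulr_gt0 => //; exact: mulr_gt0.
  have : a * (e - E0) >= a * (e / 2) by rewrite ler_pM2l //; lra.
  have : 0 < a * (e / 2) - 2 * al * e * (h0 + rho * X).
    have -> : a * (e / 2) - 2 * al * e * (h0 + rho * X) = e / 2.
      by rewrite /a; field.
    by rewrite divr_gt0.
  lra.
move=> z /andP[z1 z2] zr.
have Az : A z by apply: tubeA; [apply/andP; lra|exact: ltW].
apply: lt_le_trans (comp _ Az); rewrite ltrDl psiE.
have -> : c z.2 = 0.
  rewrite /c (max_idPr _) ?subr_le0 // (max_idPr _) ?subr_le0 //.
  by rewrite expr0n addr0.
by rewrite mulr0 subr0 mulr_gt0 // subr_gt0 ltr_expR !mulNr ltrN2 ltr_pM2l.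
Qed.

(** The Gaussian amplitude turns the barrier into [del] times the difference of two exponentials,
    which is positive exactly in the space-time ball of radius [rho] about [(y, tau)]. Its linear
    lower bound at the sphere yields the stated growth. *)
Lemma hopf_in_ball (A : set ('rV[R]_n * R)) (u : 'rV[R]_n * R -> R)
    (m : R) (y : 'rV[R]_n) (tau rho : R) :
  open A -> lsc_on A u -> viscosity_supersolution H A u ->
  (forall z, A z -> m <= u z) -> 0 < rho ->
  (forall z, tau - rho <= z.2 <= tau + rho -> tube_sq y 0 z < rho ^+ 2 ->
     A z /\ m < u z) ->
  exists2 kap, 0 < kap & forall z, A z ->
    m + kap * (rho ^+ 2 - tube_sq y 0 z - (z.2 - tau) ^+ 2) <= u z.
Proof.
move=> oA lu su mu rho0 ballA.
(* Makes [L * c0 = c0 + rho], which outweighs the term [z.2 - tau] coming from the time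
   derivative. *)
pose L := 1 + rho / c0.
have L1 : 1 <= L by rewrite lerDl divr_ge0 // ltW.
have Lc0 : L * c0 = c0 + rho by rewrite /L mulrDl mul1r divfK ?gt_eqF.
pose al := 2 * (L * Lam) / rho ^+ 2.
have LLam : 1 <= L * Lam by rewrite -[1]mulr1 ler_pM.
have rho20 : 0 < rho ^+ 2 by rewrite exprn_gt0.
have alrho : al * rho ^+ 2 = 2 * (L * Lam) by rewrite divfK ?gt_eqF.
have al0 : 0 < al by rewrite divr_gt0 //; lra.
clearbody al L.
have half : (rho / 2) ^+ 2 = rho ^+ 2 / 4 by field.
(* On the inner tube, compact in the region [m < u], lower semicontinuity gives a uniform gap. As
   [psi <= del], no contact occurs there, and elsewhere the distance to [y] is large enough for
   [H_outer_ge]. *)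
have [del del0 delP] : exists2 del, 0 < del & forall z : 'rV[R]_n * R,
    tau - rho <= z.2 <= tau + rho -> tube_sq y 0 z <= (rho / 2) ^+ 2 ->
    m + del <= u z.
  pose K := [set z : 'rV[R]_n * R | tau - rho <= z.2 <= tau + rho /\
    tube_sq y 0 z <= (rho / 2) ^+ 2].
  have KA z : K z -> A z /\ m < u z.
    by move=> [zt zr]; apply: ballA => //; apply: le_lt_trans zr _; rewrite half; lra.
  have [|||z1 Kz1 z1P] := @compact_lsc_min R _ u K.
  - exists (y, tau); split=> /=; first by apply/andP; lra.
    rewrite /tube_sq big1 => [|i _]; first exact: sqr_ge0.
    by rewrite /tube_off mxE mulr0 !subrr expr0n.
  - by apply: compact_tube; rewrite divr_ge0 // ltW.
  - by move=> x /KA[Ax _] a ax; apply: (lsc_on_near A).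
  exists (u z1 - m); first by rewrite subr_gt0; have [] := KA _ Kz1.
  by move=> z zt zr; rewrite addrC subrK; exact: z1P.
pose At t := del * expR (- al * (t - tau) ^+ 2).
pose B0 := del * expR (- al * rho ^+ 2).
pose dA t := - (2 * al * (t - tau)) * At t.
have dAt t : is_derive t (1 : R) At (dA t).
  have h1 : is_derive t (1 : R) (fun t => t - tau) 1.
    by apply: is_derive_affine => h; rewrite [h *: 1]mulr1; ring.
  have h2 : is_derive (t - tau) (1 : R) (fun x => x ^+ 2) (2 * (t - tau)).
    by have := @is_deriveX _ _ (id : R -> R) 2 (t - tau) 1 1 _;
      rewrite expr1 [_ *: 1]mulr1; exact.
  have h3 := is_derive_comp_real _ _ _ _ _ _ h1 h2.
  have h4 := is_derive_comp_real _ _ _ _ _ _ h3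
    (is_derive_expRZ del (- al) ((t - tau) ^+ 2)).
  by apply: is_derive_eq h4 _; rewrite /dA /At; ring.
have At0 t : 0 < At t by rewrite mulr_gt0 ?expR_gt0.
have Ac : continuous At := amplitude_continuous At _ dAt.
have dAc : continuous dA.
  move=> t; apply: cvgM; last exact: Ac.
  apply: cvgN; apply: cvgM; first exact: cvg_cst.
  by apply: cvgB; [exact: cvg_id|exact: cvg_cst].
have dB t : is_derive t (1 : R) (cst B0) (cst 0 t) by exact: is_derive_cst.
have d0c : continuous (cst (0 : R) : R -> R) by move=> t; exact: cvg_cst.
pose psi := barrier At (cst B0) al y 0.
have psiC := barrier_C2x_C1t y 0 al At (cst B0) dA (cst 0) dAt dB dAc d0c.
have AtE z : At z.2 * tube_exp al y 0 z =
    del * expR (- al * (tube_sq y 0 z + (z.2 - tau) ^+ 2)).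
  by rewrite /At /tube_exp -mulrA -expRD; congr (_ * expR _); ring.
have psiE z : psi z =
    del * expR (- al * (tube_sq y 0 z + (z.2 - tau) ^+ 2)) - B0.
  by rewrite -AtE.
have psi_lt z : 0 < psi z -> tube_sq y 0 z + (z.2 - tau) ^+ 2 < rho ^+ 2.
  by rewrite psiE subr_gt0 ltr_pM2l // ltr_expR !mulNr ltrN2 ltr_pM2l.
have psi_in z : 0 < psi z ->
    tau - rho < z.2 < tau + rho /\ tube_sq y 0 z < rho ^+ 2.
  move=> /psi_lt zr; have := tube_sq_ge0 y 0 z => sq0.
  split; last by have := sqr_ge0 (z.2 - tau); lra.
  have : `|z.2 - tau| < rho.
    rewrite -(@ltr_pXn2r _ 2) ?nnegrE ?(ltW rho0) // real_normK ?num_real //.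
    by lra.
  by rewrite ltr_norml => /andP[? ?]; apply/andP; lra.
have psidel z : psi z <= del.
  rewrite psiE lerBlDr -[leLHS]mulr1 -mulrA.
  have : 0 < B0 by rewrite mulr_gt0 ?expR_gt0.
  have : expR (- al * (tube_sq y 0 z + (z.2 - tau) ^+ 2)) <= 1.
    rewrite -expR0 ler_expR mulNr oppr_le0 mulr_ge0 ?(ltW al0) //.
    by rewrite addr_ge0 ?tube_sq_ge0 ?sqr_ge0.
  by rewrite mulr1 => e1 B00; have := ler_wpM2l (ltW del0) e1; rewrite mulr1; lra.
have comp z : A z -> m + psi z <= u z.
  apply: (comparison H A) => //.
  - move=> e e0.
    have cT := compact_tube y 0 (tau - rho) (tau + rho) rho (ltW rho0).
    (* The closed tube may leave [A] at its lateral boundary. Intersecting with [e <= psi] keeps the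
       compact set inside the open ball. *)
    exists ([set z | tau - rho <= z.2 <= tau + rho /\ tube_sq y 0 z <= rho ^+ 2]
      `&` psi @^-1` [set x | e <= x]); split.
    + apply: compact_closedI => //; apply: closed_comp => [w _|]; last exact: closed_ge.
      exact: (barrier_continuous y 0 al At (cst B0) dA (cst 0)).
    + move=> w [[wt _] /= ew]; have w0 : 0 < psi w by exact: lt_le_trans ew.
      by have [_ ws] := psi_in _ w0; have [] := ballA w wt ws.
    + move=> w Aw ew; have w0 : 0 < psi w by exact: lt_le_trans ew.
      have [/andP[w1 w2] ws] := psi_in _ w0.
      by split=> //; split; [rewrite !ltW|exact: ltW].
  - move=> {}z Az p0 uz; have [/andP[z1 z2] zs] := psi_in _ p0.
    have far : rho ^+ 2 / 4 < tube_sq y 0 z.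
      rewrite ltNge; apply/negP => near.
      have : m + del <= u z by apply: delP; rewrite ?half // !ltW.
      by have := psidel z; lra.
    rewrite /psi (H_hess_barrier _ _ dA (cst 0)) //.
    rewrite (Dt_barrier y 0 al At (cst B0) dA (cst 0)) //.
    rewrite big1 => [|i _]; last by rewrite mxE mulr0.
    set e := tube_exp al y 0 z; set Hv := H _.
    have e0 : 0 < e by exact: expR_gt0.
    have rowE : \sum_i (\row_i tube_off y 0 z i) 0 i ^+ 2 = tube_sq y 0 z.
      by apply: eq_bigr => i _; rewrite mxE.
    have HvL : L * c0 <= Hv.
      apply: H_outer_ge => //; rewrite rowE.
        by apply: le_lt_trans far; rewrite divr_ge0 // ltW.
      apply: (@le_trans _ _ (2 * al * (rho ^+ 2 / 4))); first by have := alrho; lra.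
      by rewrite ler_pM2l ?ltW // mulr_gt0.
    have -> : 2 * al * (At z.2 * e) * Hv - (dA z.2 * e + At z.2 * e * (2 * al * 0) -
        cst 0 z.2) = 2 * (al * (At z.2 * e)) * (Hv + (z.2 - tau)).
      by rewrite /dA /cst; ring.
    have HvS : 0 < Hv + (z.2 - tau).
      by move: HvL c00 z1; rewrite Lc0; move: Hv z.2 => a b; lra.
    by do 3 apply: mulr_gt0 => //; exact: mulr_gt0.
(* The slope comes from [1 + x <= expR x] with [x] equal to [al] times the bracket, after factoring
   out [B0]. *)
exists (B0 * al); first by rewrite !mulr_gt0 ?expR_gt0.
move=> z Az; apply: le_trans (comp _ Az); rewrite lerD2l psiE.
set w := tube_sq y 0 z; set t2 := (z.2 - tau) ^+ 2.
have -> : - al * (w + t2) = - al * rho ^+ 2 + al * (rho ^+ 2 - w - t2) by ring.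
rewrite expRD mulrA -/B0.
have B00 : 0 <= B0 by rewrite mulr_ge0 ?expR_ge0 // ltW.
by have := ler_wpM2l B00 (expR_ge1Dx (al * (rho ^+ 2 - w - t2))); lra.
Qed.

(** * Propagation of positivity to later times in the whole domain *)

Section strong_minimum.
Variables (Omega : set 'rV[R]_n) (T m : R) (u : 'rV[R]_n * R -> R).
Local Notation A := (cylinder Omega T).
Hypotheses (oO : open Omega) (lu : lsc_on A u)
  (su : viscosity_supersolution H A u) (mu : forall z, A z -> m <= u z).

(** A thin tube joins [(p, s)] to [(q, s')]. Its middle stays in the ball by convexity, and its
    short extensions beyond both end times stay in the cylinder by openness, so [tube_positivity]
    applies. *)
Lemma positivity_in_ball (o p q : 'rV[R]_n) (r s s' : R) :
  (ball o r `<=` Omega) -> ball o r p -> ball o r q -> 0 < s -> s < s' ->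
  s' < T -> m < u (p, s) -> m < u (q, s').
Proof.
move=> brO bp bq s0 ss' s'T mp.
have r0 : 0 < r by case: bp.
have oA : open A by exact: cylinder_open.
have Ap : A (p, s) by split=> /=; [exact: brO|apply/andP; lra].
have Aq : A (q, s') by split=> /=; [exact: brO|apply/andP; lra].
pose del := (u (p, s) - m) / 2.
have del0 : 0 < del by rewrite divr_gt0 ?subr_gt0.
have [r1 r10 r1P] : exists2 r : R, 0 < r & forall z : 'rV[R]_n * R,
    (forall i, `|z.1 0 i - p 0 i| < r) -> `|z.2 - s| < r -> A z /\ m + del < u z.
  apply: near_box; near=> z; split; near: z.
    exact: open_nbhs_nbhs.
  by apply: (lsc_on_near A) => //; rewrite /del; lra.
have [r2 r20 r2P] : exists2 r : R, 0 < r & forall z : 'rV[R]_n * R,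
    (forall i, `|z.1 0 i - q 0 i| < r) -> `|z.2 - s'| < r -> A z.
  by apply: near_box; exact: open_nbhs_nbhs.
(* [r - d] is the room left around the segment from [p] to [q] inside the sup-norm ball. *)
have [d dr [dp dq]] : exists2 d, d < r &
    (forall i, `|p 0 i - o 0 i| <= d) /\ (forall i, `|q 0 i - o 0 i| <= d).
  exists (Num.max `|p - o| `|q - o|).
    by move: bp bq; rewrite -ball_normE /= gt_max !(distrC o) => -> ->.
  have co (v : 'rV[R]_n) i : `|v 0 i| <= `|v|.
    rewrite [leRHS]/Num.Def.normr /= mx_normrE.
    exact: (@le_bigmax _ _ _ 0 (fun ij => `|v ij.1 ij.2|) (0, i)).
  split=> i; rewrite le_max; apply/orP; [left|right].
    by have := co (p - o) i; rewrite !mxE.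
  by have := co (q - o) i; rewrite !mxE.
(* The centre [y + t xi] is at [p] at time [s] and at [q] at time [s']. *)
pose xi := (s' - s)^-1 *: (q - p).
pose y := p - s *: xi.
have ss0 : 0 < s' - s by rewrite subr_gt0.
have qE i : q 0 i = p 0 i + (s' - s) * xi 0 i.
  by rewrite /xi !mxE mulVKf ?gt_eqF //; ring.
have offp (z : 'rV[R]_n * R) i : z.1 0 i - p 0 i = tube_off y xi z i + (z.2 - s) * xi 0 i.
  by rewrite /tube_off /y !mxE; ring.
pose Xi := 1 + \sum_i `|xi 0 i|.
have Xi1 : 1 <= Xi by rewrite lerDl sumr_ge0.
have xiXi i : `|xi 0 i| <= Xi.
  rewrite /Xi (bigD1 i) //= addrCA lerDl addr_ge0 // sumr_ge0 //.
pose mu12 := Num.min r1 r2.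
have mu0 : 0 < mu12 by rewrite lt_min r10.
have mur1 : mu12 <= r1 by rewrite ge_min lexx.
have mur2 : mu12 <= r2 by rewrite ge_min lexx orbT.
pose eta := mu12 / (4 * Xi).
have eta0 : 0 < eta by rewrite divr_gt0 // mulr_gt0 //; lra.
have etaXi : eta * Xi = mu12 / 4 by rewrite /eta; field; rewrite gt_eqF //; lra.
have etamu : eta <= mu12 / 4 by rewrite -etaXi ler_peMr // ltW.
pose rho := Num.min (mu12 / 4) ((r - d) / 2).
have rho0 : 0 < rho by rewrite lt_min !divr_gt0 // subr_gt0.
have rhomu : rho <= mu12 / 4 by rewrite ge_min lexx.
have rhod : rho <= (r - d) / 2 by rewrite ge_min lexx orbT.
(* Offset and drift add up to at most [mu12 / 4 + mu12 / 4], which is why both [rho] and [eta * Xi]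
   are bounded by [mu12 / 4]. *)
have close a b i : `|a| <= rho -> `|b| <= eta -> `|a + b * xi 0 i| < mu12.
  move=> ar be; apply: le_lt_trans (ler_normD _ _) _; rewrite normrM.
  have : `|b| * `|xi 0 i| <= eta * Xi by exact: ler_pM.
  lra.
have init (z : 'rV[R]_n * R) : s - eta <= z.2 <= s -> tube_sq y xi z <= rho ^+ 2 ->
    A z /\ m + del < u z.
  move=> /andP[z1 z2] zr; have zo i := tube_off_le y xi z rho i (ltW rho0) zr.
  have zs : `|z.2 - s| <= eta by rewrite ler_norml; apply/andP; lra.
  apply: r1P => [i|]; last by lra.
  by rewrite offp; apply: lt_le_trans mur1; exact: close.
have main : forall z : 'rV[R]_n * R, s <= z.2 <= s' ->
    tube_sq y xi z < rho ^+ 2 -> m < u z.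
  apply: (tube_positivity A u m y xi s s' rho eta del) => //.
  - by move=> z [_ /andP[]].
  - move=> z /andP[z1 z2] zr.
    have zo i := tube_off_le y xi z rho i (ltW rho0) zr.
    have [zs|sz] := lerP z.2 s.
      by have [|] := init z _ zr; first by rewrite z1.
    have [zs'|s'z] := ltrP z.2 s'; last first.
      have zs : `|z.2 - s'| <= eta by rewrite ler_norml; apply/andP; lra.
      apply: r2P => [i|]; last by lra.
      have -> : z.1 0 i - q 0 i = tube_off y xi z i + (z.2 - s') * xi 0 i.
        by rewrite qE opprD addrA offp; ring.
      by apply: lt_le_trans mur2; exact: close.
    split=> /=; last by apply/andP; lra.
    apply: brO; apply/rV_ball => // i.
    pose l := (z.2 - s) / (s' - s).
    have l0 : 0 <= l by rewrite divr_ge0 //; lra.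
    have l1 : l <= 1 by rewrite ler_pdivrMr // mul1r; lra.
    have lE : z.2 - s = l * (s' - s) by rewrite divfK ?gt_eqF.
    clearbody l.
    have -> : z.1 0 i - o 0 i =
        tube_off y xi z i + ((1 - l) * (p 0 i - o 0 i) + l * (q 0 i - o 0 i)).
      have -> : z.1 0 i = tube_off y xi z i + (z.2 - s) * xi 0 i + p 0 i.
        by rewrite -offp subrK.
      by rewrite lE qE; ring.
    apply: le_lt_trans (ler_normD _ _) _.
    have : `|(1 - l) * (p 0 i - o 0 i) + l * (q 0 i - o 0 i)| <= d.
      apply: le_trans (ler_normD _ _) _; rewrite !normrM (ger0_norm l0).
      rewrite ger0_norm ?subr_ge0 //.
      have := ler_wpM2l l0 (dq i).
      have := @ler_wpM2l _ (1 - l) _ _ _ (dp i); rewrite subr_ge0 => /(_ l1).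
      lra.
    by have := zo i; lra.
  - by move=> z zt zr; have [_ /ltW] := init z zt zr.
apply: main => /=; first by rewrite (ltW ss') lexx.
rewrite /tube_sq big1 ?exprn_gt0 // => i _.
suff -> : tube_off y xi (q, s') i = 0 by rewrite expr0n.
by have := offp (q, s') i; rewrite /= qE; lra.
Unshelve. all: by end_near. Qed.

(** The points where [u > m] at every time in [(tau, T)] form a nonempty subset, open and closed
    relative to the connected [Omega]. *)
Lemma strong_minimum (p x : 'rV[R]_n) (tau t : R) :
  connected Omega -> Omega p -> 0 < tau -> m < u (p, tau) ->
  Omega x -> tau < t < T -> m < u (x, t).
Proof.
move=> conO Op tau0 mp.
pose B := [set x | Omega x /\ forall t, tau < t < T -> m < u (x, t)].
suff -> : Omega = B by move=> [_ Bx] /Bx.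
have ballO q : Omega q -> exists2 r, 0 < r & ball q r `<=` Omega.
  by move=> Oq; apply/nbhs_ballP; exact: open_nbhs_nbhs.
have spread o r q q' : 0 < r -> ball o r `<=` Omega -> ball o r q ->
    ball o r q' -> B q -> B q'.
  move=> r0 brO bq bq' [_ Bq]; split=> [|t' /andP[t1 t2]]; first exact: brO.
  (* An intermediate time leaves room for the strictly positive duration of a tube, so passing from
     [q] to [q'] loses none of the times after [tau]. *)
  pose t3 := (tau + t') / 2.
  apply: (positivity_in_ball o q q' r t3) => //; rewrite /t3; try lra.
  by apply: Bq; apply/andP; lra.
apply/esym; apply: conO.
- exists p; split=> // t' /andP[t1 t2]; have [r r0 rO] := ballO _ Op.
  by apply: (positivity_in_ball p p p r tau) => //; exact: ballxx.
- exists B; last by apply/seteqP; split=> z [].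
  rewrite openE => q Bq; have [r r0 rO] := ballO q Bq.1.
  apply/nbhs_ballP; exists r => // q' bq'.
  by apply: (spread q r q) => //; exact: ballxx.
- exists (closure B); first exact: closed_closure.
  apply/seteqP; split=> [z Bz|q [Oq cq]].
    by split; [exact: Bz.1|exact: subset_closure].
  have [r r0 rO] := ballO q Oq.
  have [q' [Bq' bq']] := cq _ (nbhsx_ballx q _ r0).
  by apply: (spread q r q') => //; exact: ballxx.
Qed.

End strong_minimum.

End elliptic_operator.

(** [M_of H Lam < 0] bounds both arguments of the maximum. The second one says that the infimum over
    the sphere is positive, and this infimum is [c0]. *)
Lemma ellipticity_of_conditions {R : realType} {n : nat} (H : 'M[R]_n -> R) :
  condition_A (fun _ X => H X) -> condition_B 1 (fun _ X => H X) ->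
  condition_C (fun _ X => H X) ->
  exists Lam c0 : R, [/\ 1 <= Lam /\ 0 < c0,
    forall X Y, symmetric_mx X -> symmetric_mx Y -> psd_mx (Y - X) -> H X <= H Y,
    forall X, symmetric_mx X -> forall a, 0 < a -> H (a *: X) = a * H X &
    forall e, unit_sphere e -> c0 <= H (Lam *: outer e - 1%:M)].
Proof.
move=> [_ _ mono] [k1 [_ _ hom _]] [_ [Lam [Lam1 MLam]]].
have := MLam _ (lexx _); rewrite /M_of gt_max oppr_lt0 => /andP[_].
set S := [set _ | _ in _] => S0; exists Lam, (inf S); split=> //.
- by move=> X Y sX sY; exact: mono 0 X Y sX sY.
- by move=> X sX a a0; have [_ ->] := hom 0 X sX.
- move=> e ee; apply: ge_inf; last by exists e.
  (* Without a lower bound, [inf S] would be the default value 0, against [0 < inf S]. *)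
  by have [[]|/inf_out Sout] := pselect (has_inf S); last by rewrite Sout ltxx in S0.
Qed.

(** * Geometry of C^2 boundaries *)

Lemma mean_value_along {R : realType} {V : normedModType R} (f : V -> R)
    (z v : V) (h M : R) :
  (forall s, `|s| <= `|h| ->
     derivable f (s *: v + z) v /\ `|'D_v f (s *: v + z)| <= M) ->
  `|f (h *: v + z) - f z| <= M * `|h|.
Proof.
move=> fM; pose g s := f (s *: v + z).
have dg (s : R) : `|s| <= `|h| -> is_derive s (1 : R) g ('D_v f (s *: v + z)).
  move=> /fM[/derivableP /is_derive_along df _]; apply/is_derive_along.
  suff -> : (fun k : R => g (k *: 1 + s)) = fun k => f (k *: v + (s *: v + z)) by [].
  by apply/funext => k; rewrite /g [k *: 1]mulr1 scalerDl addrA.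
have gc (a b : R) : (forall s, a <= s <= b -> `|s| <= `|h|) ->
    {within `[a, b], continuous g}.
  move=> abh; apply: derivable_within_continuous => s; rewrite in_itv /= => /abh.
  by move=> /dg[].
have gM (a b : R) : a <= b -> (forall s, a <= s <= b -> `|s| <= `|h|) ->
    `|g b - g a| <= M * (b - a).
  move=> ab abh.
  have [||c] := @MVT_segment _ g (fun s => 'D_v f (s *: v + z)) a b ab.
  - by move=> x; rewrite in_itv /= => /andP[/ltW xa /ltW xb]; apply/dg/abh; rewrite xa.
  - exact: gc.
  - rewrite in_itv /= => /abh /fM[_ cM] ->.
    by rewrite normrM (ger0_norm (_ : 0 <= b - a)) ?subr_ge0 // ler_wpM2r ?subr_ge0.
have g0 : g 0 = f z by rewrite /g scale0r add0r.
rewrite -g0 -/(g h); have [h0|h0] := leP 0 h.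
  rewrite (ger0_norm h0) -[X in _ * X]subr0; apply: gM => // s /andP[s0 sh].
  by rewrite !ger0_norm.
rewrite (ltr0_norm h0) distrC -[X in _ * X]add0r; apply: gM; first exact: ltW.
by move=> s /andP[sh s0]; rewrite (ltr0_norm h0) ler0_norm // lerN2.
Qed.

(** One mean value estimate per coordinate direction, whence the factor [n]; all intermediate points
    remain in the box. *)
Lemma partial_lipschitz {R : realType} {n : nat} (f : 'rV[R]_n -> R)
    (a x : 'rV[R]_n) (r M : R) :
  0 <= M ->
  (forall z : 'rV[R]_n, (forall i, `|z 0 i - a 0 i| <= r) -> forall i,
     derivable f z (ebase R i) /\ `|'D_(ebase R i) f z| <= M) ->
  (forall i, `|x 0 i - a 0 i| <= r) ->
  `|f x - f a| <= n%:R * (M * r).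
Proof.
move=> M0 fM xr.
(* Change the coordinates one at a time. *)
pose path k := \row_j (if (j < k)%N then x 0 j else a 0 j).
have pathn : path n = x by apply/rowP => j; rewrite mxE ltn_ord.
have path0 : path 0%N = a by apply/rowP => j; rewrite mxE.
suff /(_ n (leqnn n)) : forall k, (k <= n)%N -> `|f (path k) - f a| <= k%:R * (M * r).
  by rewrite pathn.
elim=> [_|k IH kn]; first by rewrite path0 subrr normr0 mul0r.
pose i := Ordinal kn.
have step : path k.+1 = (x 0 i - a 0 i) *: ebase R i + path k.
  apply/rowP => j; rewrite !mxE eqxx /=.
  have [->|ji] := eqVneq j i; first by rewrite /= ltnn ltnSn mulr1 subrK.
  rewrite mulr0 add0r ltnS leq_eqVlt.
  by have /negbTE -> : (j != k :> nat) by [].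
have -> : f (path k.+1) - f a = (f (path k.+1) - f (path k)) + (f (path k) - f a).
  by rewrite addrA subrK.
apply: le_trans (ler_normD _ _) _.
rewrite -natr1 mulrDl mul1r [leRHS]addrC; apply: lerD; last exact: IH (ltnW kn).
have : `|f (path k.+1) - f (path k)| <= M * `|x 0 i - a 0 i|.
  rewrite step; apply: mean_value_along => s sx; apply: fM => j.
  rewrite !mxE eqxx /=; have [->|ji] := eqVneq j i.
    by rewrite /= ltnn mulr1 addrK (le_trans sx) // xr.
  rewrite mulr0 add0r; case: ifP => // _; rewrite subrr normr0.
  exact: le_trans (xr i).
by move=> fh; apply: le_trans fh _; rewrite ler_wpM2l.
Qed.

Lemma near_rV_box {R : realType} {n : nat} (p : 'rV[R]_n) (P : 'rV[R]_n -> Prop) :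
  (\forall x \near p, P x) -> exists2 r : R, 0 < r &
    forall x : 'rV[R]_n, (forall i, `|x 0 i - p 0 i| < r) -> P x.
Proof.
by move=> /nbhs_ballP [r /= r0 rP]; exists r => // z zp; apply/rP/rV_ball.
Qed.

Lemma norm_le_sum2 {R : realType} {n : nat} (c : 'I_n -> 'I_n -> R) i j :
  `|c i j| <= \sum_i \sum_j `|c i j|.
Proof.
rewrite (bigD1 i) //= (bigD1 j) //= -addrA lerDl.
by rewrite addr_ge0 // sumr_ge0 // => k _; rewrite sumr_ge0.
Qed.

(** Two uses of [partial_lipschitz]: the second partials bound the variation of the first ones,
    which are in turn the partials of [g] minus its linear part. *)
Lemma C2_taylor {R : realType} {n : nat} (g : 'rV[R]_n -> R) (a : 'rV[R]_n) :
  C2 g -> exists C r : R, [/\ 0 <= C, 0 < r &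
    forall (x : 'rV[R]_n) (rho : R), 0 <= rho < r ->
      (forall i, `|x 0 i - a 0 i| <= rho) ->
      `|g x - g a - \sum_i 'D_(ebase R i) g a * (x 0 i - a 0 i)| <= C * rho ^+ 2].
Proof.
move=> gC2.
(* By continuity, each second partial stays within 1 of its value at [a] on a small box. *)
pose M := 1 + \sum_i \sum_j `|'D_(ebase R i) ('D_(ebase R j) g) a|.
have M0 : 0 <= M by rewrite addr_ge0 // sumr_ge0 // => i _; rewrite sumr_ge0.
have [r r0 rP] : exists2 r, 0 < r &
    forall x : 'rV[R]_n, (forall i, `|x 0 i - a 0 i| < r) ->
    forall i j, `|'D_(ebase R i) ('D_(ebase R j) g) x| <= M.
  apply: near_rV_box; near=> x => i; move: i; near: x.
  apply: filter_forall => i; near=> x => j; move: j; near: x.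
  apply: filter_forall => j.
  have [_ _ /(_ i j) [_ /cvgrPdist_lt /(_ 1 ltr01)]] := gC2 a.
  pose D x := 'D_(ebase R i) ('D_(ebase R j) g) x; rewrite -/(D a) => Dc.
  near=> x; rewrite -/(D x).
  have : `|D a - D x| < 1 by near: x.
  move=> Dlt.
  have DM : `|D a| <= \sum_i \sum_j `|'D_(ebase R i) ('D_(ebase R j) g) a|.
    exact: (norm_le_sum2 (fun i j => 'D_(ebase R i) ('D_(ebase R j) g) a)).
  rewrite -[D x](subrK (D a)) (le_trans (ler_normD _ _)) // distrC.
  by rewrite /M lerD // ltW.
exists (n%:R * (n%:R * M)), r; split=> //; first by rewrite !mulr_ge0.
move=> x rho /andP[rho0 rhor] xa.
have lin_diff (z : 'rV[R]_n) j : (forall i, `|z 0 i - a 0 i| <= rho) ->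
    `|'D_(ebase R j) g z - 'D_(ebase R j) g a| <= n%:R * (M * rho).
  apply: (partial_lipschitz ('D_(ebase R j) g)) => // w wa i; split.
    by have [_ _ /(_ i j) []] := gC2 w.
  by apply: rP => k; exact: le_lt_trans rhor.
pose h z := g z - \sum_i 'D_(ebase R i) g a * z 0 i.
have hd z i : is_derive z (ebase R i) h ('D_(ebase R i) g z - 'D_(ebase R i) g a).
  have d1 : is_derive z (ebase R i) g ('D_(ebase R i) g z).
    by apply: derivableP; have [_ /(_ i)[]] := gC2 z.
  have d2 : is_derive z (ebase R i) (fun z => \sum_j 'D_(ebase R j) g a * z 0 j)
      ('D_(ebase R i) g a).
    apply: is_derive_affine => k; under eq_bigr do rewrite !mxE mulrDr.
    rewrite big_split /= addrC; congr (_ + _); rewrite (bigD1 i) //= big1.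
      by rewrite !eqxx addr0 mulr1 mulrC.
    by move=> j /negbTE ->; rewrite ?andbF !mulr0.
  exact: is_deriveB.
have := @partial_lipschitz _ _ h a x rho (n%:R * (M * rho)).
have -> : h x - h a = g x - g a - \sum_i 'D_(ebase R i) g a * (x 0 i - a 0 i).
  under [in RHS]eq_bigr do rewrite mulrBr.
  by rewrite sumrB /h; ring.
have -> : n%:R * (n%:R * (M * rho) * rho) = n%:R * (n%:R * M) * rho ^+ 2 by ring.
apply=> //; first by rewrite !mulr_ge0.
move=> z za i; have hz := hd z i; split; first by [].
by rewrite derive_val; exact: lin_diff.
Unshelve. all: by end_near. Qed.

(** The slope function [f s / s] vanishes at 0, because [f 0 = 0], and is O(s) near 0. *)
Lemma is_derive_quadratic_bound {R : realType} (f : R -> R) (K : R) :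
  f 0 = 0 -> (\forall s \near (0 : R), `|f s| <= K * s ^+ 2) ->
  is_derive (0 : R) (1 : R) f 0.
Proof.
move=> f0 fK; apply/is_derive1_caratheodory; exists (fun s => f s / s); split.
- move=> z; rewrite f0 !subr0; have [->|z0] := eqVneq z 0; last by rewrite divfK.
  by rewrite mulr0; exact: f0.
- have : (f s / s) @[s --> (0 : R)] --> (0 : R); last first.
    by rewrite /prop_for /continuous_at /= f0 mul0r.
  apply/cvgrPdist_lt => e e0; near=> s.
  rewrite sub0r normrN; have [->|s0] := eqVneq s 0.
    by rewrite f0 mul0r normr0.
  have s0' : 0 < `|s| by rewrite normr_gt0.
  have fs : `|f s| <= K * s ^+ 2 by near: s.
  have K0 : 0 < `|K| + 1 by rewrite ltr_wpDl.
  have se : `|s| < e / (`|K| + 1).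
    by near: s; apply: (@nbhs0_lt R R); rewrite divr_gt0.
  rewrite normrM normfV ltr_pdivrMr //; apply: le_lt_trans fs _.
  rewrite -real_normK ?num_real // expr2 mulrA ltr_pM2r //.
  move: se; rewrite ltr_pdivlMr // => se.
  have : K * `|s| <= `|K| * `|s| by rewrite ler_pM2r // ler_norm.
  lra.
- by rewrite f0 mul0r.
Unshelve. all: by end_near. Qed.

(** * Domains lying above a C^2 graph near a boundary point *)

Section graph_boundary.
Context {R : realType} {n : nat}.
Variables (Omega : set 'rV[R]_n.+1) (p : 'rV[R]_n.+1) (i : 'I_n.+1) (b : bool)
  (g : 'rV[R]_n -> R).
Hypotheses (oO : open Omega) (bp : boundary Omega p) (gC2 : C2 g).

Local Notation sg := ((-1) ^+ b : R).

Definition graph_height (x : 'rV[R]_n.+1) : R := sg * x 0 i - g (col' i x).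

Local Notation F := graph_height.

Hypothesis OF : \forall x \near p, Omega x <-> 0 < F x.

Lemma graph_taylor : exists (nu : 'rV[R]_n.+1) (C r : R),
  [/\ 0 < \sum_k nu 0 k ^+ 2, 0 < C, 0 < r &
    forall (x : 'rV[R]_n.+1) (rho : R), 0 <= rho < r ->
      (forall k, `|x 0 k - p 0 k| <= rho) ->
      `|F x - F p - \sum_k nu 0 k * (x 0 k - p 0 k)| <= C * rho ^+ 2].
Proof.
have [C [r [C0 r0 Cr]]] := C2_taylor g (col' i p) gC2.
pose nu := \row_k (if unlift i k is Some j then
  - 'D_(ebase R j) g (col' i p) else sg).
exists nu, (C + 1), r; split=> //.
- rewrite (bigD1 i) //= mxE unlift_none -exprM mulnC exprM sqrrN expr1n expr1n.
  by rewrite ltr_pwDl // sumr_ge0 // => k _; exact: sqr_ge0.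
- by rewrite ltr_wpDl.
- move=> x rho rhor xp; have rho0 : 0 <= rho by case/andP: rhor.
  have := Cr (col' i x) rho rhor.
  rewrite (bigD1_ord i) //= mxE unlift_none.
  under [in X in _ -> X]eq_bigr do rewrite mxE liftK.
  under eq_bigr do rewrite !mxE.
  set S := \sum_i0 _; under eq_bigr do rewrite mulNr; rewrite sumrN -/S.
  move=> h; have /h {h} : forall k, `|col' i x 0 k - col' i p 0 k| <= rho.
    by move=> k; rewrite !mxE.
  have -> : F x - F p - (sg * (x 0 i - p 0 i) - S) =
      - (g (col' i x) - g (col' i p) - S) by rewrite /F; ring.
  rewrite normrN => /le_trans; apply; rewrite ler_wpM2r ?sqr_ge0 //.
  by rewrite lerDl.
Qed.

Lemma graph_height_shift (x : 'rV[R]_n.+1) (t : R) :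
  F (x + (t * sg) *: ebase R i) = F x + t.
Proof.
rewrite /F; have -> : col' i (x + (t * sg) *: ebase R i) = col' i x.
  by apply/rowP => k; rewrite !mxE eq_sym (negbTE (neq_lift _ _)) andbF mulr0 addr0.
rewrite !mxE !eqxx /= mulr1 mulrDr mulrCA -expr2 -exprM mulnC exprM sqrrN.
by rewrite !expr1n; ring.
Qed.

(** A positive height would put [p] in the open set [Omega], of whose interior it is not a point. A
    negative height would persist near [p], which is a limit of points of [Omega]. *)
Lemma graph_height_boundary : F p = 0.
Proof.
have [nu [C [r [nu0 C0 r0 Fr]]]] := graph_taylor.
have [r1 r10 OFr] := near_rV_box _ _ OF.
have NOp : ~ Omega p by have [_ nip] := bp => Op; apply: nip; exact: open_nbhs_nbhs.
have Fp : F p <= 0.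
  rewrite leNgt; apply/negP => F0; apply: NOp; apply/OFr => //.
  by move=> k; rewrite subrr normr0.
apply/eqP; rewrite eq_le Fp leNgt; apply/negP => Fp0.
pose N := \sum_k `|nu 0 k|.
have N0 : 0 <= N by apply: sumr_ge0.
have NC : 0 < N + C by rewrite ltr_wpDl.
(* As [rho <= 1], the first and second order terms together are at most
   [(N + C) * rho <= - F p / 2]. *)
pose rho := Num.min (Num.min 1 (Num.min r r1 / 2)) (- F p / (2 * (N + C))).
have rho0 : 0 < rho.
  rewrite !lt_min ltr01 divr_gt0 ?lt_min ?r0 ?r10 //=.
  by rewrite divr_gt0 ?oppr_gt0 // mulr_gt0.
have rho1 : rho <= 1 by rewrite !ge_min lexx.
have rhor2 : rho <= Num.min r r1 / 2 by rewrite !ge_min lexx !orbT.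
have minr : Num.min r r1 <= r by rewrite ge_min lexx.
have minr1 : Num.min r r1 <= r1 by rewrite ge_min lexx orbT.
have rhor : rho < r by lra.
have rhor1 : rho < r1 by lra.
have rhoF : (N + C) * rho <= - F p / 2.
  have : rho <= - F p / (2 * (N + C)) by rewrite !ge_min lexx !orbT.
  by rewrite ler_pdivlMr; [lra|rewrite mulr_gt0].
have [|x [Ox px]] := bp.1 (ball p rho); first exact: nbhsx_ballx.
have xp k : `|x 0 k - p 0 k| < rho by move/(rV_ball _ _ _ rho0): px.
have Fx : 0 < F x by apply/OFr => // k; exact: lt_trans rhor1.
have := Fr x rho; rewrite (ltW rho0) rhor => /(_ isT (fun k => ltW (xp k))).
have : \sum_k nu 0 k * (x 0 k - p 0 k) <= N * rho.
  rewrite /N mulr_suml; apply: ler_sum => k _; apply: le_trans (ler_norm _) _.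
  by rewrite normrM ler_wpM2l // ltW.
have : C * rho ^+ 2 <= C * rho by rewrite ler_pM2l // expr2 ler_piMl // ltW.
rewrite ler_norml; set S := \sum_k _ => h1 h2 /andP[_ h3].
by move: rhoF; rewrite mulrDl; lra.
Qed.

(** Small balls centred on the normal line and touching the boundary at [p] lie in [Omega], since
    the linear part of [F] dominates the quadratic error there. A direction with negative normal
    component leaves [Omega]; one with zero component is the velocity of a curve on the graph. *)
Lemma interior_ball : exists (nu : 'rV[R]_n.+1) (s0 : R),
  [/\ 0 < \sum_k nu 0 k ^+ 2, 0 < s0,
    forall (s : R) (x : 'rV[R]_n.+1), 0 < s < s0 ->
      \sum_k (x 0 k - p 0 k - s * nu 0 k) ^+ 2 < s ^+ 2 * \sum_k nu 0 k ^+ 2 ->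
      Omega x &
    forall gam, points_inward Omega p gam -> ~ tangent_to_boundary Omega p gam ->
      0 < \sum_k nu 0 k * gam 0 k].
Proof.
have [nu [C [r [nu0 C0 r0 Fr]]]] := graph_taylor.
have [r1 r10 OFr] := near_rV_box _ _ OF.
have Fp := graph_height_boundary.
pose N := 1 + \sum_k `|nu 0 k|.
have N0 : 0 < N by rewrite ltr_pwDl // sumr_ge0.
(* The first bound keeps the ball within the range of the Taylor estimate and of [OF]; the second
   makes the error [C * d2] less than half of the linear term [V]. *)
exists nu, (Num.min (Num.min r r1 / (2 * N)) (1 / (4 * C))); split=> //.
- by rewrite lt_min !divr_gt0 ?lt_min ?r0 ?r10 ?mulr_gt0.
- move=> s x /andP[s0]; rewrite lt_min => /andP[sr sC] xs.
  have {}sC : 4 * C * s < 1 by move: sC; rewrite ltr_pdivlMr ?mulr_gt0 //; lra.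
  pose V := \sum_k nu 0 k * (x 0 k - p 0 k).
  pose d2 := \sum_k (x 0 k - p 0 k) ^+ 2.
  have d20 : 0 <= d2 by apply: sumr_ge0 => k _; exact: sqr_ge0.
  (* Expanding the square in the ball condition: the terms in [s ^+ 2] cancel. *)
  have d2V : d2 < 2 * s * V.
    have : \sum_k (x 0 k - p 0 k - s * nu 0 k) ^+ 2 =
        d2 - 2 * s * V + s ^+ 2 * \sum_k nu 0 k ^+ 2.
      rewrite /d2 /V !mulr_sumr -sumrB -big_split /=.
      by apply: eq_bigr => k _; ring.
    by move: xs => /[swap] ->; lra.
  pose rho := Num.sqrt d2.
  have rho0 : 0 <= rho by exact: sqrtr_ge0.
  have rho2 : rho ^+ 2 = d2 by exact: sqr_sqrtr.
  have xrho k : `|x 0 k - p 0 k| <= rho.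
    rewrite -sqrtr_sqr ler_sqrt // /d2 (bigD1 k) //= lerDl.
    by apply: sumr_ge0 => j _; exact: sqr_ge0.
  have s20 : 0 < 2 * s by rewrite mulr_gt0.
  have V0 : 0 < V by rewrite -(pmulr_rgt0 V s20); exact: le_lt_trans d2V.
  have VN : V <= N * rho.
    apply: (@le_trans _ _ ((\sum_k `|nu 0 k|) * rho)); last first.
      by rewrite ler_wpM2r // lerDr.
    rewrite mulr_suml; apply: ler_sum => k _; apply: le_trans (ler_norm _) _.
    by rewrite normrM ler_wpM2l.
  have rhos : rho < 2 * s * N.
    rewrite ltNge; apply/negP => srho.
    have : 2 * s * V <= rho ^+ 2.
      apply: (@le_trans _ _ (2 * s * (N * rho))); first by rewrite ler_pM2l ?mulr_gt0.
      by rewrite mulrA expr2 ler_wpM2r.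
    by rewrite rho2; lra.
  have rhom : rho < Num.min r r1.
    by apply: lt_trans rhos _; move: sr; rewrite ltr_pdivlMr ?mulr_gt0 //; lra.
  move: rhom; rewrite lt_min => /andP[rhor rhor1].
  apply/OFr => [k|]; first exact: le_lt_trans rhor1.
  have := Fr x rho; rewrite rho0 rhor => /(_ isT xrho).
  rewrite Fp subr0 -/V rho2 ler_norml => /andP[FV _].
  have : C * d2 <= C * (2 * s * V) by rewrite ler_pM2l // ltW.
  have : 4 * C * s * V < V by rewrite gtr_pMl.
  lra.
- move=> gam inw ntan.
  pose G := 1 + \sum_k `|gam 0 k|.
  have G0 : 0 < G by rewrite ltr_pwDl // sumr_ge0.
  have gamG k : `|gam 0 k| <= G.
    by rewrite /G (bigD1 k) //= addrCA lerDl addr_ge0 // sumr_ge0.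
  pose V := \sum_k nu 0 k * gam 0 k.
  have Fgam s : `|s| < r / G -> `|F (p + s *: gam) - s * V| <= C * G ^+ 2 * s ^+ 2.
    rewrite ltr_pdivlMr // => sr.
    have := Fr (p + s *: gam) (`|s| * G).
    have -> : \sum_k nu 0 k * ((p + s *: gam) 0 k - p 0 k) = s * V.
      by rewrite mulr_sumr; apply: eq_bigr => k _; rewrite !mxE; ring.
    rewrite Fp subr0 exprMn real_normK ?num_real // mulrA mulrAC; apply.
      by rewrite sr mulr_ge0 // ltW.
    by move=> k; rewrite !mxE addrAC subrr add0r normrM ler_wpM2l.
  have rG0 : 0 < r / G by rewrite divr_gt0.
  have CG0 : 0 < C * G ^+ 2 by rewrite mulr_gt0 ?exprn_gt0.
  (* If [V < 0], then [F] at [p + s *: gam] is at most [s * V] plus a quadratic error, hence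
     negative for small [s > 0], although these points are in [Omega]. *)
  have V0 : 0 <= V.
    rewrite leNgt; apply/negP => V0.
    near (0 : R)^'+ => s.
    have s0 : 0 < s by near: s; exact: nbhs_right_gt.
    have sr : s < r / G by near: s; exact: nbhs_right_lt.
    have sr1 : s < r1 / G by near: s; apply: nbhs_right_lt; rewrite divr_gt0.
    have sV : s < - V / (C * G ^+ 2).
      by near: s; apply: nbhs_right_lt; rewrite divr_gt0 // oppr_gt0.
    have Os : Omega (p + s *: gam) by near: s; exact: inw.
    have : 0 < F (p + s *: gam).
      apply/OFr => // k; rewrite !mxE addrAC subrr add0r normrM gtr0_norm //.
      by apply: le_lt_trans (_ : s * G < r1); [rewrite ler_pM2l|rewrite -ltr_pdivlMr].
    have := Fgam s; rewrite gtr0_norm // => /(_ sr); rewrite ler_norml => /andP[_].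
    move: sV; rewrite ltr_pdivlMr // => sV.
    by have : s * (s * (C * G ^+ 2)) < s * - V by [rewrite ltr_pM2l|]; lra.
  rewrite lt_neqAle V0 andbT eq_sym; apply/eqP => Vz; apply: ntan.
  have {}Vz : V = 0 by [].
  (* Moving [p + s gam] vertically onto the graph costs only O(s^2). *)
  pose kap s := - F (p + s *: gam) * sg.
  pose c (s : R) := p + s *: gam + kap s *: ebase R i.
  exists c.
  have sgn : `|sg| = 1 by rewrite normrX normrN1 expr1n.
  have kap_bound s : `|s| < r / G -> `|kap s| <= C * G ^+ 2 * s ^+ 2.
    by move=> /Fgam; rewrite Vz mulr0 subr0 /kap normrM normrN sgn mulr1.
  have kap0 : kap 0 = 0 by rewrite /kap scale0r addr0 Fp oppr0 mul0r.
  have dkap : is_derive (0 : R) (1 : R) kap 0.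
    apply: (is_derive_quadratic_bound _ (C * G ^+ 2)) => //.
    near=> s; apply: kap_bound; near: s.
    exact: (@nbhs0_lt R R).
  have dck k : is_derive (0 : R) (1 : R) (fun s => c s 0 k) (gam 0 k).
    have -> : (fun s => c s 0 k) =
        (fun s => p 0 k + s * gam 0 k) + (ebase R i 0 k) *: kap.
      apply/funext => s.
      have -> : c s 0 k = p 0 k + s * gam 0 k + kap s * ebase R i 0 k.
        by rewrite /c !mxE.
      by rewrite [kap s * _]mulrC.
    have d1 : is_derive (0 : R) (1 : R) (fun s => p 0 k + s * gam 0 k) (gam 0 k).
      by apply: is_derive_affine => h; rewrite [h *: 1]mulr1; ring.
    have := is_deriveD d1 (is_deriveZ (ebase R i 0 k) dkap).
    by rewrite scaler0 addr0.
  have dc : derivable c 0 1.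
    by apply/derivable_mxP => j k; rewrite ord1; have [] := dck k.
  have c0 : c 0 = p by rewrite /c kap0 !scale0r !addr0.
  split=> //; last first.
    split=> //; rewrite derive_mx //; apply/rowP => k; rewrite mxE.
    by have := dck k => dk; rewrite derive_val.
  pose U := [set x | Omega x <-> 0 < F x]°.
  have oU : open U by exact: open_interior.
  have Up : U p by [].
  have cc : {for 0, continuous c}.
    by apply/differentiable_continuous/derivable1_diffP.
  have nU : \forall s \near (0 : R), U (c s).
    by apply: cc; rewrite c0; exact: open_nbhs_nbhs.
  apply: filterS nU => s Us.
  (* A point on the graph is a limit of points slightly above it, which lie in [Omega], and is not
     itself in [Omega], having zero height. *)
  have Fc : F (c s) = 0.
    by rewrite /c /kap graph_height_shift subrr.
  split.
    move=> B nB; have : nbhs (c s) (B `&` U).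
      by apply: filterI => //; exact: open_nbhs_nbhs.
    move=> /nbhs_ballP[e /= e0 eBU].
    pose x := c s + (e / 2 * sg) *: ebase R i.
    have [Bx /interior_subset Ux] : (B `&` U) x.
      apply: eBU; apply/rV_ball => // k; rewrite /x; move: (c s) => w.
      rewrite !mxE addrAC subrr add0r normrM (normrM _ sg) sgn mulr1 eqxx /=.
      have : `|(k == i)%:R : R| <= 1 by case: eqP; rewrite ?normr1 ?normr0.
      have e20 : 0 <= `|e / 2| by [].
      rewrite gtr0_norm ?divr_gt0 // in e20 *.
      by move=> k1; apply: le_lt_trans (ler_wpM2l e20 k1) _; lra.
    exists x; split=> //; apply/Ux; rewrite graph_height_shift Fc add0r.
    by rewrite divr_gt0.
  move=> /interior_subset Oc; have /interior_subset [/(_ Oc)] := Us.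
  by rewrite Fc ltxx.
Unshelve. all: by end_near. Qed.

End graph_boundary.

(** * The Hopf boundary principle and the strong minimum principle *)

Lemma limf_einf_right_gt0 {R : realType} (f : R -> R) (c : R) :
  0 < c -> (\forall x \near (0 : R)^'+, c <= f x) ->
  (0 < limf_einf (fun x => (f x)%:E) ((0 : R)^'+))%E.
Proof.
move=> c0 fc; rewrite limf_einfE; apply: (@lt_le_trans _ _ c%:E) => //.
apply: (@le_trans _ _ (ereal_inf ((fun x => (f x)%:E) @` [set x | c <= f x]))).
  by apply: le_ereal_inf_tmp => _ [x cx <-]; rewrite lee_fin.
by apply: ereal_sup_ubound; exists [set x | c <= f x].
Qed.

Lemma inf_on_le {R : realType} {n : nat} (A : set ('rV[R]_n * R))
    (u : 'rV[R]_n * R -> R) z : A z -> (inf_on A u <= (u z)%:E)%E.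
Proof. by move=> Az; apply: ereal_inf_lbound; exists z. Qed.

Theorem theorem1p1 (R : realType) (n : nat) (Omega : set 'rV[R]_n) (T : R)
    (H : 'M[R]_n -> R) (u : 'rV[R]_n * R -> R)
    (hn : (2 <= n)%N)
    (hOmega : bounded_domain Omega)
    (hT : 0 < T)
    (hA : condition_A (fun _ X => H X))
    (hB : condition_B 1 (fun _ X => H X))
    (hC : condition_C (fun _ X => H X))
    (hlsc : lsc_on (cylinder Omega T) u)
    (hu : viscosity_supersolution H (cylinder Omega T) u) :
  let m := inf_on (cylinder Omega T) u in
  (C2_boundary Omega ->
   forall (p : 'rV[R]_n) (tau : R) (gam : 'rV[R]_n) (gamt : R) (theta0 : R),
     boundary Omega p -> 0 < tau < T ->
     (u (p, tau))%:E = m ->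
     (\forall z \near (p, tau), cylinder Omega T z -> (m < (u z)%:E)%E) ->
     gamt <= 0 ->
     ~ tangent_to_boundary Omega p gam ->
     points_inward Omega p gam ->
     0 < theta0 ->
     (forall theta : R, 0 < theta < theta0 ->
        cylinder Omega T (p + theta *: gam, tau + theta * gamt)) ->
     (0 < limf_einf
            (fun theta : R =>
               ((u (p + theta *: gam, tau + theta * gamt)
                 - u (p, tau)) / theta)%:E)
            ((0 : R)^'+))%E) /\
  (forall (p : 'rV[R]_n) (tau : R),
     cylinder Omega T (p, tau) -> (m < (u (p, tau))%:E)%E ->
     forall (x : 'rV[R]_n) (t : R),
       Omega x -> tau < t < T -> (m < (u (x, t))%:E)%E) /\
  (forall (p : 'rV[R]_n) (tau : R),
     cylinder Omega T (p, tau) -> (u (p, tau))%:E = m ->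
     forall (x : 'rV[R]_n) (t : R),
       Omega x -> 0 < t < tau -> (u (x, t))%:E = m).
Proof.
case: n Omega H u hn hOmega hA hB hC hlsc hu => // n Omega H u _ [_ oO cO _] hA hB hC lu su m.
have [Lam [c0 [[Lam1 c00] Hmono Hhom Hpos]]] := ellipticity_of_conditions H hA hB hC.
have oA : open (cylinder Omega T) by exact: cylinder_open.
have mle z : cylinder Omega T z -> (m <= (u z)%:E)%E by exact: inf_on_le.
have partb (p : 'rV[R]_n.+1) (tau : R) :
    cylinder Omega T (p, tau) -> (m < (u (p, tau))%:E)%E ->
    forall (x : 'rV[R]_n.+1) (t : R),
      Omega x -> tau < t < T -> (m < (u (x, t))%:E)%E.
  (* The infimum is an extended real: if it is [-oo] the conclusion is immediate, and [+oo] is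
     excluded by [m < u]. *)
  move=> [/= Op /andP[tau0 _]]; case: m mle => [m0| |] mle mp x t Ox tt.
  - rewrite lte_fin in mp *.
    apply: (strong_minimum H Lam c0 Lam1 c00 Hmono Hhom Hpos Omega T m0 u oO lu su _
      p x tau t) => //.
  - by rewrite ltNge leey in mp.
  - exact: ltNyr.
split; last first.
  split=> // p tau Ap mp x t Ox /andP[t0 tt].
  have tT : t < T by case: Ap => _ /andP[_ /(lt_trans tt)].
  have Ax : cylinder Omega T (x, t) by split=> //=; rewrite t0.
  (* Contrapositive of [partb]: a value above [m] at the earlier time [t] would force [u (p, tau)]
     above [m]. *)
  apply/eqP; rewrite eq_le mle // andbT leNgt; apply/negP => mx.
  have := partb x t Ax mx p tau Ap.1; rewrite tt /= mp ltxx => /(_ _)/negP; apply.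
    by case: Ap => _ /andP[].
  by [].
move=> C2O p tau gam gamt theta0 bp /andP[tau0 tauT] mp mnear _ ntan inw th0 Ath.
have mu z : cylinder Omega T z -> u (p, tau) <= u z.
  by move=> /mle; rewrite -mp lee_fin.
have [i [b [g [gC2 OF]]]] := C2O p bp.
have {}OF : \forall x \near p, Omega x <-> 0 < graph_height i b g x.
  by apply: filterS OF => x; rewrite /graph_height subr_gt0.
have [nu [s0 [nu0 s00 ball_in inward]]] := interior_ball Omega p i b g oO bp gC2 OF.
have V0 := inward gam inw ntan.
have [r1 r10 mr1] := near_box p tau _ mnear.
set q := \sum_k nu 0 k ^+ 2 in nu0 ball_in.
set V := \sum_k nu 0 k * gam 0 k in V0.
have Q0 : 0 < Num.sqrt q by rewrite sqrtr_gt0.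
have Qq : Num.sqrt q ^+ 2 = q by rewrite sqr_sqrtr // ltW.
move: (Num.sqrt q) Q0 Qq => Q Q0 Qq.
(* A radius below [mu0] keeps the times in [(0, T)]; as the ball touches [p], its points are within
   [2 * rho < r1] of [p], where [u > m]. *)
pose mu0 := Num.min (Num.min tau (T - tau)) (r1 / 2).
have mu00 : 0 < mu0 by rewrite !lt_min tau0 subr_gt0 tauT divr_gt0.
have mutau : mu0 <= tau by rewrite !ge_min lexx.
have muT : mu0 <= T - tau by rewrite !ge_min lexx !orbT.
have mur1 : mu0 <= r1 / 2 by rewrite !ge_min lexx !orbT.
clearbody mu0.
(* [Q] is the length of [nu], so [s * Q] is the radius of the interior ball centred at
   [p + s *: nu]. *)
have [s ss0 sQ] : exists2 s, 0 < s < s0 & s * Q < mu0.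
  exists (Num.min (s0 / 2) (mu0 / Q / 2)).
    rewrite lt_min !divr_gt0 //= gt_min; apply/orP; left; lra.
  rewrite -ltr_pdivlMr // gt_min; apply/orP; right.
  by have := divr_gt0 mu00 Q0; lra.
have /andP[s_gt0 _] := ss0.
pose rho := s * Q; have rho0 : 0 < rho by rewrite mulr_gt0.
pose y := p + s *: nu.
have sqE (z : 'rV[R]_n.+1 * R) :
    tube_sq y 0 z = \sum_k (z.1 0 k - p 0 k - s * nu 0 k) ^+ 2.
  by apply: eq_bigr => k _; rewrite /tube_off /y !mxE; ring.
have rho2 : rho ^+ 2 = s ^+ 2 * q by rewrite exprMn Qq.
have yp k : `|y 0 k - p 0 k| <= rho.
  rewrite /y !mxE addrAC subrr add0r normrM gtr0_norm // ler_pM2l //.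
  rewrite -(@ler_pXn2r _ 2) ?nnegrE ?(ltW Q0) // real_normK ?num_real // Qq.
  by rewrite /q (bigD1 k) //= lerDl sumr_ge0 // => j _; exact: sqr_ge0.
have [|kap kap0 kapP] := hopf_in_ball H Lam c0 Lam1 c00 Hmono Hhom Hpos
    (cylinder Omega T) u (u (p, tau)) y tau rho oA lu su mu rho0.
  move=> z /andP[z1 z2] zr.
  have Az : cylinder Omega T z.
    split; last by apply/andP; rewrite /rho in z1 z2; lra.
    by apply: (ball_in s) => //; rewrite -sqE -rho2.
  split=> //; rewrite -lte_fin mp; apply: (mr1 z) => //.
    move=> k; have := tube_off_le y 0 z rho k (ltW rho0) (ltW zr).
    have -> : z.1 0 k - p 0 k = tube_off y 0 z k + (y 0 k - p 0 k).
      by rewrite /tube_off [X in _ * X]mxE; ring.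
    move=> ok; apply: le_lt_trans (ler_normD _ _) _.
    by have := yp k; rewrite /rho in ok *; lra.
  by rewrite ltr_norml; apply/andP; rewrite /rho in z1 z2; lra.
pose G := \sum_k gam 0 k ^+ 2 + gamt ^+ 2.
have G0 : 0 <= G by rewrite addr_ge0 ?sqr_ge0 // sumr_ge0 // => k _; exact: sqr_ge0.
apply: (limf_einf_right_gt0 _ (kap * (s * V))); first by rewrite !mulr_gt0.
near=> th.
have th_gt0 : 0 < th by near: th; exact: nbhs_right_gt.
have th_lt : th < theta0 by near: th; exact: nbhs_right_lt.
have thG : th < s * V / (G + 1).
  by near: th; apply: nbhs_right_lt; rewrite divr_gt0 ?mulr_gt0 // ltr_wpDl.
rewrite ler_pdivlMr //.
have Az : cylinder Omega T (p + th *: gam, tau + th * gamt).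
  by apply: Ath; rewrite th_gt0.
have := kapP _ Az; rewrite sqE /=.
rewrite (_ : tau + th * gamt - tau = th * gamt) ?rho2; last by ring.
have -> : \sum_k ((p + th *: gam) 0 k - p 0 k - s * nu 0 k) ^+ 2 =
    th ^+ 2 * \sum_k gam 0 k ^+ 2 - 2 * th * s * V + s ^+ 2 * q.
  rewrite /V /q !mulr_sumr -sumrB -big_split /=.
  by apply: eq_bigr => k _; rewrite !mxE; ring.
set S := \sum_k gam 0 k ^+ 2 => hu.
(* The bracket in [kapP] equals [th * (2 * s * V - th * G)], with no constant term as [p] is on the
   sphere. For [th * G <= s * V], half of the linear term survives. *)
have : kap * (s * V) * th <= kap * (th * (2 * s * V - th * G)).
  rewrite -mulrA ler_pM2l // mulrC ler_pM2l //.
  move: thG; rewrite ltr_pdivlMr ?ltr_wpDl // => thG.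
  by move: thG; rewrite mulrDr mulr1; lra.
have -> : kap * (th * (2 * s * V - th * G)) =
    kap * (s ^+ 2 * q - (th ^+ 2 * S - 2 * th * s * V + s ^+ 2 * q) - (th * gamt) ^+ 2).
  by rewrite /G -/S; ring.
lra.
Unshelve. all: by end_near. Qed.
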